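(* Let $n,k\geq 1$ and $0\leq s\leq n-1$ be integers. Then the two polynomials \[ \mathcal{L}^k_{n,s}(x)=\sum_{a=0}^{s}\sum_{b=a}^{n}\mathcal{N}^k_{(a,b)}(x), \qquad \mathcal{R}^k_{n,s}(x)=\sum_{b=s+1}^{n}\mathcal{N}^k_{(s+1,b)}(x) \] have a common interleaver.
   Context: For a nonnegative integer $m$, $[m]=\{1,\dots,m\}$ (with $[0]=\varnothing$) is a chain with its usual order; products of chains are ordered coordinatewise. An ideal of a poset $P$ is a subset $I$ such that $x\leq y$ and $y\in I$ imply $x\in I$; $\max(I)$ is the set of maximal elements of $I$. Transfer polynomials: for a finite poset $Q$, an ideal $I$ of $Q$ and $k\geq 1$, \[ \mathcal{N}_I^k(x)=\sum_{I_1\subseteq\cdots\subseteq I_{k-1}\subseteq I_k=I} x^{\sum_{j=1}^{k}|\max(I_j)\setminus I_{j-1}|},\qquad I_0=\varnothing, \] where the sum is over all chains of ideals $I_1\subseteq\cdots\subseteq I_k$ of $Q$ with $I_k=I$. Here $Q=[2]\times[n]$, whose ideals are $I(a,b)=(\{1\}\times[b])\cup(\{2\}\times[a])$ for $0\leq a\leq b\leq n$, and $\mathcal{N}^k_{(a,b)}(x)=\mathcal{N}^k_{I(a,b)}(x)$. Interlacing: for nonzero real-rooted polynomials $p,q$ (nonzero real polynomials all of whose zeros are real), list the zeros with multiplicity in weakly decreasing order as $p_1\geq p_2\geq\cdots$ and $q_1\geq q_2\geq\cdots$. Write $p\preceq q$ if $\deg p\leq\deg q\leq\deg p+1$ and the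 two root lists alternate as $q_1\geq p_1\geq q_2\geq p_2\geq\cdots$, including every root and allowing equality. A nonzero real-rooted polynomial $h$ is a common interleaver of $p$ and $q$ if $p\preceq h$ and $q\preceq h$. (In particular, $p$ and $q$ are then themselves nonzero and real-rooted.) *)

(* Defs.v *)
From HB Require Import structures.
From mathcomp Require Import all_boot all_order all_algebra.
From mathcomp Require Import reals complex.

Set Implicit Arguments.
Unset Strict Implicit.
Unset Printing Implicit Defensive.

Import Order.TTheory GRing.Theory Num.Theory.

Local Open Scope ring_scope.

Section Transfer.
Context {d : Order.disp_t} {Q : finPOrderType d}.
Implicit Type I : {set Q}.

Definition is_ideal I : bool :=
  [forall x, forall y, (x <= y)%O && (y \in I) ==> (x \in I)].

Definition max_set I : {set Q} :=
  [set x in I | [forall y in I, ~~ (x < y)%O]].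

(* [c] lists I_0, I_1, ..., I_k, the initial I_0 = set0 being included. *)
Definition ideal_chain k I (c : {ffun 'I_k.+1 -> {set Q}}) : bool :=
  [&& [forall j, is_ideal (c j)],
      c ord0 == set0,
      c ord_max == I &
      [forall j : 'I_k, c (widen_ord (leqnSn k) j) \subset c (lift ord0 j)]].

Definition chain_weight k (c : {ffun 'I_k.+1 -> {set Q}}) : nat :=
  (\sum_(j < k)
     #|max_set (c (lift ord0 j)) :\: c (widen_ord (leqnSn k) j)|)%N.

Definition transfer_poly (R : nzRingType) k I : {poly R} :=
  \sum_(c : {ffun 'I_k.+1 -> {set Q}} | ideal_chain I c) 'X^(chain_weight c).

End Transfer.

(* The chain [m] = {1, ..., m} is represented by 'I_m, its elements being
   shifted down by one; [*p] carries the coordinatewise order. *)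
Definition chain2 (n : nat) := ('I_2 *p 'I_n)%type.

Definition ideal_ab (n a b : nat) : {set chain2 n} :=
  setX [set ord0] [set j : 'I_n | (j < b)%N]
    :|: setX [set ord_max] [set j : 'I_n | (j < a)%N].

Definition Nab (R : nzRingType) (n k a b : nat) : {poly R} :=
  transfer_poly R k (ideal_ab n a b).

Definition Lpoly (R : nzRingType) (n k s : nat) : {poly R} :=
  \sum_(0 <= a < s.+1) \sum_(a <= b < n.+1) Nab R n k a b.

Definition Rpoly (R : nzRingType) (n k s : nat) : {poly R} :=
  \sum_(s.+1 <= b < n.+1) Nab R n k s.+1 b.

Section Interlacing.
Context {R : realType}.
Implicit Types (p q h : {poly R}) (s : seq R).

Definition real_rooted p : Prop :=
  p != 0 /\
  forall z : R[i], root (map_poly (real_complex R) p) z -> z \is Num.real.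

Definition zero_list p s : Prop :=
  sorted >=%R s /\ forall x, count_mem x s = mup x p.

(* For polynomials the degree is (size _).-1; p and q being nonzero, the
   inequalities on sizes are those on degrees.  They also make every index
   below range inside both zero lists. *)
Definition interlaces p q : Prop :=
  [/\ real_rooted p, real_rooted q,
      (size p <= size q <= (size p).+1)%N &
      exists ps qs : seq R,
        [/\ zero_list p ps, zero_list q qs,
            forall i, (i < size ps)%N -> ps`_i <= qs`_i &
            forall i, (i.+1 < size qs)%N -> qs`_i.+1 <= ps`_i]].

Definition common_interleaver p q h : Prop :=
  [/\ real_rooted h, interlaces p h & interlaces q h].

End Interlacing.

(* Main.v *)
Require Import Defs.
From mathcomp Require Import all_boot all_order all_algebra.
From mathcomp Require Import reals complex.
From mathcomp Require Import polyrcf ring lra zify.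

(* Put P_s = sum_i C(s,i) C(k,i) x^i and U_{n,k} = sum_i C(n-1,i-1) C(k+1,i+1) x^i.
   The sums of transfer polynomials over all ideals inside I(s,n) have the
   determinantal form L_s = P_n P_s - U_{n,k} U_{k,s}, so that R_s = L_{s+1} - L_s.
   With E_s = sum_i C(s,i) C(k,i) x^i / (i+1) one has P_s = E_s + x E_s',
   U_{k,s} = c (P_s - E_s) for c = (s+1)/k, and for T = P_n - c U_{n,k} both
   polynomials are governed by T:
     L_s = P_s T + c U_{n,k} E_s,     R_s = k x E_{s,k-1} T.
   Since E_s interlaces both P_s and x E_{s,k-1}, while T interlaces U_{n,k}, the
   product E_s T interlaces L_s as well as R_s.  Hence the numbers of zeros of L_s
   and R_s in any half-line [t, oo) differ by at most one, and the pointwise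
   maximum of the two zero lists yields a common interleaver. *)

Set Implicit Arguments.
Unset Strict Implicit.
Unset Printing Implicit Defensive.
Import Order.TTheory GRing.Theory Num.Theory.
Local Open Scope ring_scope.

(** * Interlacing from sign conditions *)

Section StrictInterlacing.
Variable R : rcfType.
Implicit Types (fs gs s : seq R) (f g p q : {poly R}).

(** The constant c has two roles: it is the ratio of U_{k,s} to P_s - E_s, and also the ratio of the
    increments U_{k,s+1} - U_{k,s} = (s+1) x E_{s,k-1} and P_{s+1} - P_s = k x E_{s,k-1}. This is
    why the same T occurs in both determinants. Three degeneracies shape the rest. One has T = E_n +
    g x E_n' with g of either sign, so the sign of U_{n,k} at the zeros of T is read off a
    Wronskian. The top coefficient of T may vanish, so degrees can be off by one. And E_s and T may
    share zeros, so E_s T need not be squarefree. The condition s < n enters through k g >= -1,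
    which keeps the coefficients of T nonnegative. The determinant comes from an induction on k:
    removing the last ideal of a chain leaves a sum over smaller ideals I(a',b') weighted by
    x^[a' < a] and, when a < b, by x^[b' < b]. Both weighted sums telescope, and Pascal's rule turns
    the results into differences at k+1. *)

Definition root_prod s : {poly R} := \prod_(z <- s) ('X - z%:P).
Definition count_ge t s : nat := count (fun z => t <= z) s.

Lemma root_prod_cons a s : root_prod (a :: s) = ('X - a%:P) * root_prod s.
Proof. by rewrite /root_prod big_cons. Qed.

Lemma root_prod_cat s1 s2 :
  root_prod (s1 ++ s2) = root_prod s1 * root_prod s2.
Proof. by rewrite /root_prod big_cat. Qed.

Lemma perm_root_prod s1 s2 : perm_eq s1 s2 -> root_prod s1 = root_prod s2.
Proof. exact: perm_big. Qed.

Lemma size_root_prod s : size (root_prod s) = (size s).+1.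
Proof. exact: size_prod_XsubC. Qed.

Lemma monic_root_prod s : root_prod s \is monic.
Proof. exact: monic_prod_XsubC. Qed.

Lemma root_prod_neq0 s : root_prod s != 0.
Proof. exact: monic_neq0 (monic_root_prod s). Qed.

Lemma root_root_prod s x : root (root_prod s) x = (x \in s).
Proof. exact: root_prod_XsubC. Qed.

Lemma horner_root_prod_eq0 s x : ((root_prod s).[x] == 0) = (x \in s).
Proof. exact: root_root_prod. Qed.

Lemma horner_deriv_root_prod_cons a s x :
  (root_prod (a :: s))^`().[x] =
    (root_prod s).[x] + (x - a) * (root_prod s)^`().[x].
Proof. by rewrite root_prod_cons derivM derivXsubC !hornerE. Qed.

Lemma root_prod_gt0 s x : all (fun z => z < x) s -> 0 < (root_prod s).[x].
Proof.
elim: s => [|a s IH] /=; first by rewrite /root_prod big_nil hornerE.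
by case/andP=> ax /IH sx; rewrite root_prod_cons !hornerE mulr_gt0 // subr_gt0.
Qed.

(** The moving bound [M] lets a recursion restart at the zero of [fs] just passed, as the
    intermediate value argument below requires. *)
Fixpoint alternating M gs fs : bool :=
  match gs, fs with
  | g :: gs', f :: fs' => [&& g < M, f < g & alternating f gs' fs']
  | [::], [::] => true
  | _, _ => false
  end.

Lemma alternating_size M gs fs : alternating M gs fs -> size gs = size fs.
Proof.
elim: gs M fs => [|g gs IH] M [|f fs] //= /and3P [_ _ /IH ->] //.
Qed.

Lemma alternating_path M gs fs : alternating M gs fs -> path >%R M gs.
Proof.
elim: gs M fs => [|g gs IH] M [|f fs] //= /and3P [-> fg /IH].
by case: gs {IH} => //= b gs /andP [bf ->]; rewrite (lt_trans bf fg).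
Qed.

Lemma alternating_count M gs fs t : alternating M gs fs ->
  (count_ge t fs <= count_ge t gs <= (count_ge t fs).+1)%N /\
  (M <= t -> count_ge t gs = 0%N).
Proof.
rewrite /count_ge.
elim: gs M fs => [|g gs IH] M [|f fs] //= /and3P [gM fg /IH [H1 H2]].
split; last first.
  move=> Mt; rewrite H2 ?(le_trans (ltW (lt_trans fg gM)) Mt) //.
  by rewrite leNgt (lt_le_trans gM Mt).
case: (leP t f) => tf; last first.
  move: H1; rewrite H2 ?(ltW tf) //; move: (count _ fs) => u.
  by case: (t <= g) => /=; lia.
have -> : t <= g by apply: le_trans tf (ltW fg).
by move: (count _ fs) (count _ gs) H1 => u v /=; lia.
Qed.

(* The derivative of a product of distinct linear factors changes sign from one
   root to the next, hence so does [g]. *)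
Lemma alternating_roots M fs g :
    path >%R M fs -> 0 < g.[M] ->
    (forall r, r \in fs -> (root_prod fs)^`().[r] * g.[r] < 0) ->
  exists2 gs, alternating M gs fs & all (root g) gs.
Proof.
elim: fs M g => [|a l IH] M g /=; first by move=> *; exists [::].
case/andP=> aM al gM Hr.
have la : all (fun z => z < a) l.
  by apply: order_path_min al; apply: rev_trans lt_trans.
have ga : g.[a] < 0.
  move: (Hr a); rewrite mem_head => /(_ isT).
  rewrite horner_deriv_root_prod_cons subrr mul0r addr0.
  by rewrite pmulr_rlt0 // root_prod_gt0.
have [z] := @poly_ivtoo _ g a M (ltW aM) ltac:(by rewrite nmulr_rlt0).
rewrite in_itv /= => /andP [az zM] rz.
(* To the left of [a] the factor ['X - a%:P] is negative, so the remaining zeros satisfy the sign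
   condition for [- g], with [a] as the new bound. *)
have [||gs alt_gs rgs] := IH a (- g) al.
- by rewrite hornerN oppr_gt0.
- move=> r rl; have ra : r < a by move/allP: la => /(_ r rl).
  move: (Hr r); rewrite inE rl orbT => /(_ isT).
  rewrite horner_deriv_root_prod_cons.
  have /eqP -> : (root_prod l).[r] == 0 by rewrite horner_root_prod_eq0.
  rewrite add0r hornerN -mulrA nmulr_rlt0 ?subr_lt0 //.
  by rewrite mulrN oppr_lt0.
exists (z :: gs) => /=; first by rewrite zM az.
by rewrite rz; apply: sub_all rgs => x; rewrite rootN.
Qed.

Lemma root_prod_dvd gs g : uniq gs -> all (root g) gs ->
  exists q, g = q * root_prod gs.
Proof.
by move=> ugs rgs; apply: uniq_roots_prod_XsubC => //; rewrite uniq_rootsE.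
Qed.

Lemma alternating_uniq M gs fs : alternating M gs fs -> uniq gs.
Proof.
move/alternating_path/path_sorted; apply: sorted_uniq => [|x]; last exact: ltxx.
exact: rev_trans lt_trans.
Qed.

Lemma seq_ub s : exists M, all (fun z => z < M) s.
Proof.
elim: s => [|a s [M HM]]; first by exists 0.
exists (Num.max M (a + 1)); rewrite /= lt_max ltrDl ltr01 orbT /=.
by apply: sub_all HM => z zM; rewrite lt_max zM.
Qed.

Lemma seq_lb s : exists M, all (fun z => M < z) s.
Proof.
elim: s => [|a s [M HM]]; first by exists 0.
exists (Num.min M (a - 1)); rewrite /= gt_min ltrBlDr ltrDl ltr01 orbT /=.
by apply: sub_all HM => z zM; rewrite gt_min zM.
Qed.

Lemma pos_large g b : 0 < lead_coef g -> exists2 M, b < M & 0 < g.[M].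
Proof.
move=> lg; have [n Hn] := poly_pinfty_gt_lc lg.
exists (Num.max n (b + 1)); first by rewrite lt_max ltrDl ltr01 orbT.
by apply: lt_le_trans lg (Hn _ _); rewrite le_max lexx.
Qed.

Lemma neg_small p b : 0 < lead_coef p -> ~~ odd (size p) ->
  exists2 M, M < b & p.[M] < 0.
Proof.
move=> lp op; pose q := - (p \Po - 'X).
have lq : 0 < lead_coef q.
  rewrite lead_coefN lead_coef_comp ?size_polyN ?size_polyX //.
  rewrite lead_coefN lead_coefX -signr_odd.
  have -> : odd (size p).-1.
    have : (0 < size p)%N by rewrite size_poly_gt0 -lead_coef_eq0 gt_eqF.
    by case: (size p) op => //= m; rewrite negbK.
  by rewrite expr1 mulrN1 opprK.
have [M bM] := pos_large (- b) lq.
rewrite hornerN horner_comp !hornerE oppr_gt0 => pM.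
by exists (- M) => //; rewrite ltrNl.
Qed.

Lemma decreasing_perm fs : uniq fs ->
  exists2 fs', sorted >%R fs' & perm_eq fs' fs.
Proof.
move=> ufs; exists (rev (sort <=%R fs)); last by rewrite perm_rev perm_sort.
by rewrite rev_sorted sort_lt_sorted.
Qed.

Lemma perm_count_ge t s1 s2 : perm_eq s1 s2 -> count_ge t s1 = count_ge t s2.
Proof. by move/permP; apply. Qed.

Definition interleaved fs gs : Prop :=
  forall t, (count_ge t fs <= count_ge t gs <= (count_ge t fs).+1)%N.

(** The signs force one zero of [g] above each zero of [fs], separated by them. The degree bound
    leaves room for at most one more, which must then lie below all of [fs]. *)
Theorem interlacing_of_signs fs g :
    uniq fs -> 0 < lead_coef g -> (size g <= (size fs).+2)%N ->
    (forall r, r \in fs -> (root_prod fs)^`().[r] * g.[r] < 0) ->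
  exists gs, [/\ g = lead_coef g *: root_prod gs, uniq gs & interleaved fs gs].
Proof.
move=> ufs lg sg Hr.
have [fs' sfs' pfs] := decreasing_perm ufs.
have Hr' r : r \in fs' -> (root_prod fs')^`().[r] * g.[r] < 0.
  by rewrite (perm_root_prod pfs) (perm_mem pfs); apply: Hr.
have count_fs t : count_ge t fs = count_ge t fs' by rewrite (perm_count_ge t pfs).
rewrite -(perm_size pfs) in sg => {Hr}.
have [M1 HM1] := seq_ub fs'.
have [M M1M gM] := pos_large M1 lg.
have HM : all (fun z => z < M) fs'.
  by apply: sub_all HM1 => z zM; apply: lt_trans zM M1M.
have pfs' : path >%R M fs'.
  by rewrite path_sortedE ?HM //; apply: rev_trans lt_trans.
have g0 : g != 0 by rewrite -lead_coef_eq0 gt_eqF.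
have splitg gs : uniq gs -> all (root g) gs -> size g = (size gs).+1 ->
    g = lead_coef g *: root_prod gs.
  by move=> ugs rgs sgs; apply: all_roots_prod_XsubC; rewrite ?uniq_rootsE.
have [gs alt_gs rgs] := alternating_roots pfs' gM Hr'.
have ugs := alternating_uniq alt_gs; have sgs := alternating_size alt_gs.
have := max_poly_roots g0 rgs ugs; rewrite sgs leq_eqVlt => /orP [/eqP sg'|sg'].
  exists gs; split=> //; first by apply: splitg; rewrite // sgs.
  by move=> t; rewrite count_fs; have [] := alternating_count t alt_gs.
have {sg sg'}sg : size g = (size fs').+2 by apply/eqP; rewrite eqn_leq sg.

(* Here [g] has one zero more than [fs'], so [root_prod fs' * g] has odd degree and is negative far
   to the left. A point [B] there satisfies the sign condition as a fictitious extra zero of [fs'],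
   and the alternation argument then yields the missing zero of [g], above [B]. *)
have [B1 HB1] := seq_lb fs'.
have [] := @neg_small (root_prod fs' * g) (Num.min B1 M).
- by rewrite lead_coefM (monicP (monic_root_prod _)) mul1r.
- rewrite size_monicM ?monic_root_prod // size_root_prod sg.
  by rewrite addSn !addnS /= negbK addnn odd_double.
move=> B; rewrite lt_min hornerM => /andP [BB1 BM] gB.
have HB : all (fun z => B < z) fs'.
  by apply: sub_all HB1 => z Bz; apply: lt_trans BB1 Bz.
have pB : perm_eq (rcons fs' B) (B :: fs') by rewrite perm_rcons.
have path_B : path >%R M (rcons fs' B).
  rewrite rcons_path pfs' /=.
  by case/lastP: (fs') HB BM => [|l z] //=; rewrite last_rcons all_rcons => /andP [].
have fB : (root_prod (rcons fs' B))^`().[B] = (root_prod fs').[B].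
  by rewrite (perm_root_prod pB) horner_deriv_root_prod_cons subrr mul0r addr0.
have [|gs1 alt_gs1 rgs1] := alternating_roots path_B gM _.
  move=> r; rewrite mem_rcons inE => /orP [/eqP ->|rfs].
    by rewrite fB.
  rewrite (perm_root_prod pB) horner_deriv_root_prod_cons.
  have /eqP -> : (root_prod fs').[r] == 0.
    by rewrite horner_root_prod_eq0.
  by rewrite add0r -mulrA pmulr_rlt0 ?Hr' // subr_gt0; move/allP: HB; apply.
have ugs1 := alternating_uniq alt_gs1.
have := alternating_size alt_gs1; rewrite size_rcons => sgs1.
exists gs1; split=> //; first by apply: splitg; rewrite // sgs1.
move=> t; rewrite count_fs; have [] := alternating_count t alt_gs1.
have -> : count_ge t (rcons fs' B) = ((t <= B)%R + count_ge t fs')%N.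
  by rewrite (perm_count_ge t pB).
(* The fictitious zero is counted only for [t <= B], where all of [fs'] is counted too, and the
   upper bound follows from the number of zeros of [g]. *)
case: (leP t B) => [tB|_] H _; last by rewrite add0n in H.
move: H; have -> : count_ge t fs' = size fs'.
  apply/eqP; rewrite -all_count; apply: sub_all HB => z Bz.
  by apply: ltW; apply: le_lt_trans Bz.
by case/andP=> H _; rewrite -sgs1 count_size andbT; apply: ltnW.
Qed.

(* [g] may lose one root relative to [f] at infinity, but the sign changes of
   [g] between consecutive roots of [f] leave a cofactor of degree at most 1. *)
Lemma split_of_signs fs g :
    uniq fs -> g != 0 -> (size g <= (size fs).+1)%N ->
    (forall r, r \in fs -> 0 < (root_prod fs)^`().[r] * g.[r]) ->
  exists gs, g = lead_coef g *: root_prod gs.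
Proof.
move=> ufs g0 sg Hr.
have [fs' sfs' pfs] := decreasing_perm ufs.
have {}Hr r : r \in fs' -> 0 < (root_prod fs')^`().[r] * g.[r].
  by rewrite (perm_root_prod pfs) (perm_mem pfs); apply: Hr.
rewrite -(perm_size pfs) in sg => {pfs ufs}.
case: fs' sfs' Hr sg => [|a l] /= sl Hr sg.
  by exists [::]; rewrite (size1_polyC sg) lead_coefC /root_prod big_nil alg_polyC.
have la : all (fun z => z < a) l.
  by apply: order_path_min sl; apply: rev_trans lt_trans.
have ga : 0 < g.[a].
  move: (Hr a); rewrite mem_head => /(_ isT).
  rewrite horner_deriv_root_prod_cons subrr mul0r addr0.
  by rewrite pmulr_rgt0 // root_prod_gt0.
have [r rl|gs alt_gs rgs] := alternating_roots sl ga _.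
  have ra : r < a by move/allP: la => /(_ r rl).
  move: (Hr r); rewrite inE rl orbT => /(_ isT).
  rewrite horner_deriv_root_prod_cons.
  have /eqP -> : (root_prod l).[r] == 0 by rewrite horner_root_prod_eq0.
  by rewrite add0r -mulrA nmulr_rgt0 ?subr_lt0.
have [q gE] := root_prod_dvd (alternating_uniq alt_gs) rgs.
have q0 : q != 0 by apply: contraNneq g0 => q0; rewrite gE q0 mul0r.
have lgE : lead_coef g = lead_coef q.
  by rewrite gE lead_coefM (monicP (monic_root_prod _)) mulr1.
have sq : (size q <= 2)%N.
  move: sg; rewrite gE size_Mmonic ?monic_root_prod // size_root_prod.
  by rewrite (alternating_size alt_gs); lia.
have [y qE] : exists s, q = lead_coef q *: root_prod s.
  have : (0 < size q)%N by rewrite size_poly_gt0.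
  case sqE : (size q) sq => [|[|[|//]]] // _ _.
    exists [::]; rewrite (size1_polyC (eq_leq sqE)).
    by rewrite lead_coefC /root_prod big_nil alg_polyC.
  have lq0 : q`_1 != 0 by rewrite -(lead_coef_eq0 q) lead_coefE sqE in q0 *.
  exists [:: - q`_0 / q`_1].
  rewrite root_prod_cons /root_prod big_nil mulr1 lead_coefE sqE /=.
  apply/polyP => i; rewrite coefZ coefB coefX coefC.
  case: i => [|[|i]] /=; rewrite ?sub0r ?subr0 ?mulr1 ?mulr0 ?mulNr ?opprK //.
    by rewrite mulrCA mulfV ?mulr1.
  by rewrite oppr0 mulr0 nth_default ?sqE.
exists (y ++ gs).
by rewrite lgE root_prod_cat scalerAl -qE.
Qed.

End StrictInterlacing.

(** * Zeros of a sum of two products, and a Wronskian inequality *)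

Section Sum.
Variable R : rcfType.
Implicit Types (s es ts : seq R) (p u : {poly R}).

Lemma count_ge_cat (t : R) s1 s2 :
  count_ge t (s1 ++ s2) = (count_ge t s1 + count_ge t s2)%N.
Proof. exact: count_cat. Qed.

(** At a zero of one product only one summand survives, with a known sign. Common zeros [gs] divide
    [L], so one copy of them is factored out; [fs] keeps the other copy and is free of repetitions,
    and the strict criterion applies to the quotient [L1]. *)
Lemma interlacing_of_sum es ts p u (L := p * root_prod ts + u * root_prod es) :
    uniq es -> uniq ts ->
    (forall r, r \in es -> (root_prod es)^`().[r] * p.[r] < 0) ->
    (forall r, r \in ts -> (root_prod ts)^`().[r] * u.[r] < 0) ->
    0 < lead_coef L -> (size L <= (size es + size ts).+2)%N ->
  exists2 ls, L = lead_coef L *: root_prod ls & interleaved (es ++ ts) ls.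
Proof.
move=> ues uts Hp Hu lL sL.
pose gs := [seq r <- es | r \in ts].
pose e1 := [seq r <- es | r \notin ts]; pose t1 := [seq r <- ts | r \notin es].
have pes : perm_eq es (gs ++ e1) by rewrite perm_sym; apply/permPl/perm_filterC.
have pts : perm_eq ts (gs ++ t1).
  rewrite perm_sym; apply: perm_trans (permEl (perm_filterC (mem es) ts)).
  rewrite perm_cat2r; apply: uniq_perm; rewrite ?filter_uniq // => r.
  by rewrite !mem_filter andbC.
pose fs := gs ++ e1 ++ t1.
pose L1 := p * root_prod t1 + u * root_prod e1.
have LE : L = root_prod gs * L1.
  rewrite /L (perm_root_prod pes) (perm_root_prod pts) !root_prod_cat /L1.
  by ring.
have lL1 : lead_coef L = lead_coef L1.
  by rewrite LE lead_coefM (monicP (monic_root_prod _)) mul1r.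
have ufs : uniq fs.
  rewrite /fs catA cat_uniq -(perm_uniq pes) ues filter_uniq // andbT /=.
  apply/hasPn => r; rewrite mem_filter => /andP [res _].
  by rewrite /= -(perm_mem pes).
have sfs : (size gs + size fs = size es + size ts)%N.
  by rewrite (perm_size pes) (perm_size pts) !size_cat; lia.
have [||r rfs|ls1 [L1E _ H1]] := @interlacing_of_signs _ fs L1 ufs.
- by rewrite -lL1.
- have L10 : L1 != 0 by rewrite -lead_coef_eq0 -lL1 gt_eqF.
  move: sL; rewrite LE size_monicM ?monic_root_prod // size_root_prod -sfs.
  by move: (size gs) (size fs) (size L1) => a b c; lia.
- set X := (X in X < 0).
  (* The two sides differ by a multiple of [(root_prod fs).[r]], which is zero. The squares make the
     sign independent of the other factor. *)
  have -> : X = (root_prod es)^`().[r] * p.[r] * (root_prod t1).[r] ^+ 2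
              + (root_prod ts)^`().[r] * u.[r] * (root_prod e1).[r] ^+ 2.
    have : (root_prod fs).[r] = 0 by apply/rootP; rewrite root_root_prod.
    rewrite /X /L1 (perm_root_prod pes) (perm_root_prod pts) !root_prod_cat.
    rewrite !derivM !(hornerD, hornerM).
    move: (root_prod gs).[r] (root_prod e1).[r] (root_prod t1).[r] => g e t.
    move: (root_prod gs)^`().[r] (root_prod e1)^`().[r] (root_prod t1)^`().[r].
    move=> g' e' t' get0.
    apply/eqP; rewrite -subr_eq0; apply/eqP.
    transitivity (g * (e * t) * (p.[r] * t' + u.[r] * e')); first by ring.
    by rewrite get0 mul0r.
  (* At a zero of [es] the first term is strictly negative because [t1] avoids [es]. The second is
     nonpositive at a common zero, and vanishes with [e1] otherwise. *)
  have [res|nres] := boolP (r \in es).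
    rewrite ltr_wnDr //; last first.
      rewrite nmulr_rlt0 ?Hp //.
      rewrite lt0r sqrf_eq0 sqr_ge0 andbT horner_root_prod_eq0.
      by rewrite mem_filter res.
    have [rts|nrts] := boolP (r \in ts).
      by rewrite mulr_le0_ge0 ?sqr_ge0 // ltW // Hu.
    have /eqP -> : (root_prod e1).[r] == 0.
      by rewrite horner_root_prod_eq0 mem_filter res nrts.
    by rewrite expr0n mulr0.
  have rts : r \in ts.
    move: rfs; rewrite !mem_cat !mem_filter (negbTE nres) !andbF /=.
    by [].
  have /eqP -> : (root_prod t1).[r] == 0.
    by rewrite horner_root_prod_eq0 mem_filter nres rts.
  rewrite expr0n mulr0 add0r nmulr_rlt0 ?Hu //.
  rewrite lt0r sqrf_eq0 sqr_ge0 andbT horner_root_prod_eq0.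
  by rewrite mem_filter (negbTE nres) andbF.
exists (gs ++ ls1).
  by rewrite {1}LE lL1 root_prod_cat scalerAr -L1E.
move=> t; have := H1 t; rewrite /fs !count_ge_cat.
rewrite (perm_count_ge t pes) (perm_count_ge t pts) !count_ge_cat.
move: (count_ge t gs) (count_ge t e1) (count_ge t t1) (count_ge t ls1) => a b c d.
lia.
Qed.

Definition wronskian (f g : {poly R}) : {poly R} := f * g^`() - f^`() * g.

(* The logarithmic derivative [f' / f] is a sum of terms [1 / (x - z)], and
   [x / (x - z)] has derivative [- z / (x - z) ^ 2 > 0]. *)
Lemma wronskian_root_prod_gt0 s x :
    uniq s -> all (fun z => z < 0) s -> s != [::] ->
  0 < (wronskian (root_prod s) ('X * (root_prod s)^`())).[x].
Proof.
have cons z s' : wronskian (root_prod (z :: s')) ('X * (root_prod (z :: s'))^`())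
    = ('X - z%:P) ^+ 2 * wronskian (root_prod s') ('X * (root_prod s')^`())
      - z%:P * root_prod s' ^+ 2.
  rewrite /wronskian root_prod_cons !(derivM, derivXsubC, derivX, derivD, mul1r).
  by ring.
elim: s => [|z [|z' s'] IH] //.
  rewrite cons /= andbT => _ z0 _.
  rewrite /wronskian /root_prod big_nil (@derivC _ 1).
  rewrite mulr0 derivC !mulr0 subr0 mulr0.
  by rewrite sub0r expr1n mulr1 hornerN hornerC oppr_gt0.
set s := z' :: s' in IH *; move=> us /andP [z0 s0] _.
have {}IH : 0 < (wronskian (root_prod s) ('X * (root_prod s)^`())).[x].
  by apply: IH => //; case/andP: us.
rewrite cons hornerD hornerN [(_ * wronskian _ _).[x]]hornerM [(z%:P * _).[x]]hornerM.
rewrite !horner_exp hornerC hornerXsubC -mulNr.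
(* At [x = z] the inductive term is lost, but [z] is not repeated in [s], so the square in the other
   term is positive. *)
have [->|xz] := eqVneq x z.
  rewrite subrr expr0n mul0r add0r mulr_gt0 ?oppr_gt0 //.
  rewrite lt0r sqrf_eq0 sqr_ge0 andbT horner_root_prod_eq0.
  by case/andP: us.
apply: ltr_pwDl.
  by apply: mulr_gt0 => //; rewrite lt0r sqrf_eq0 sqr_ge0 andbT subr_eq0.
by rewrite mulr_ge0 ?sqr_ge0 // oppr_ge0 ltW.
Qed.
End Sum.

(** * Narayana polynomials *)

Section NarayanaDef.
Variable R : nzRingType.

Definition narayana (s k : nat) : {poly R} :=
  \poly_(i < s.+1) ('C(s, i) * 'C(k, i))%:R.

(* The off-diagonal entry of the 2x2 determinant: its coefficient of [x ^ i] is
   [C(n - 1, i - 1) * C(k + 1, i + 1)]; the row and column parameters are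
   exchanged in the other off-diagonal entry. *)
Definition shifted_narayana (n k : nat) : {poly R} :=
  'X * \poly_(i < n.+1) ('C(n.-1, i) * 'C(k.+1, i.+2))%:R.

Lemma coef_narayana s k i : (narayana s k)`_i = ('C(s, i) * 'C(k, i))%:R.
Proof. by rewrite coef_poly ltnS; case: leqP => // /bin_small ->. Qed.

Lemma coef_shifted_narayana n k i :
  (shifted_narayana n k)`_i.+1 = ('C(n.-1, i) * 'C(k.+1, i.+2))%:R.
Proof.
rewrite coefXM coef_poly /= ltnS; case: leqP => // ni.
by rewrite bin_small // (leq_ltn_trans (leq_pred n) ni).
Qed.

Lemma coef0_shifted_narayana n k : (shifted_narayana n k)`_0 = 0.
Proof. by rewrite coefXM. Qed.

End NarayanaDef.

Section NarayanaField.
Variable R : rcfType.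
Implicit Types s k n i : nat.

Local Notation P := (@narayana R).
Local Notation U := (@shifted_narayana R).

(** The mean of [narayana s k] over [0, x], as (x E)' = P. For s = m-1 and k = m the coefficients
    are the Narayana numbers C(m,i) C(m,i+1) / m. *)
Definition narayana_mean s k : {poly R} :=
  \poly_(i < s.+1) (('C(s, i) * 'C(k, i))%:R / i.+1%:R).
Local Notation E := narayana_mean.

Lemma coef_narayana_mean s k i :
  (E s k)`_i = ('C(s, i) * 'C(k, i))%:R / i.+1%:R.
Proof. by rewrite coef_poly ltnS; case: leqP => // /bin_small ->; rewrite mul0r. Qed.

Lemma bin_leftR m i :
  i.+1%:R * 'C(m, i.+1)%:R = (m%:R - i%:R) * 'C(m, i)%:R :> R.
Proof.
have [im|mi] := leqP i m.
  by rewrite -natrB // -!natrM mul_bin_left.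
by rewrite !bin_small ?mulr0 // ltnW.
Qed.

Lemma bin_diagR m i :
  i.+1%:R * 'C(m.+1, i.+1)%:R = m.+1%:R * 'C(m, i)%:R :> R.
Proof. by rewrite -!natrM mul_bin_diag. Qed.

Lemma bin_downR m i :
  (m.+1%:R - i%:R) * 'C(m.+1, i)%:R = m.+1%:R * 'C(m, i)%:R :> R.
Proof.
have [im|mi] := leqP i m.+1.
  rewrite -natrB // -!natrM; congr _%:R.
  by have := mul_bin_down m.+1 i; rewrite /= => ->.
by rewrite !bin_small ?mulr0 // ltnW // ltnW.
Qed.

Lemma natS_neq0 i : i.+1%:R != 0 :> R.
Proof. by rewrite pnatr_eq0. Qed.

Lemma narayana_meanE s k : P s k = E s k + 'X * (E s k)^`().
Proof.
apply/polyP => i; rewrite coefD coefXM coef_deriv coef_narayana !coef_narayana_mean.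
case: i => [|i] /=; first by rewrite addr0 divr1.
rewrite -mulr_natr; field; rewrite gt_eqF //; have := ler0n R i; lra.
Qed.

(** Together with [narayana_meanE] this expresses P and U through E and x E' alone, so all signs at
    zeros of E reduce to the sign of E'. *)
Lemma shifted_narayana_mean n k : (0 < n)%N ->
  n%:R *: U n k = k.+1%:R *: ('X * (E n k)^`()).
Proof.
case: n => // n _; apply/polyP => -[|i].
  by rewrite !coefZ coef0_shifted_narayana coefXM !mulr0.
rewrite !coefZ coef_shifted_narayana coefXM /= coef_deriv coef_narayana_mean.
rewrite -mulr_natr !natrM.
have H1 := bin_diagR n i; have H2 := bin_diagR k i.+1.
apply: (mulfI (natS_neq0 i.+1)).
transitivity (n.+1%:R * 'C(n, i)%:R * (i.+2%:R * 'C(k.+1, i.+2)%:R) : R).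
  by ring.
rewrite -H1 H2; field; rewrite gt_eqF //; have := ler0n R i; lra.
Qed.

Lemma narayana_mean_sym s k : E s k = E k s.
Proof. by apply/polyP => i; rewrite !coef_narayana_mean mulnC. Qed.

Lemma narayana_diff s k :
  P s.+1 k.+1 - P s k.+1 = k.+1%:R *: ('X * E s k).
Proof.
apply/polyP => -[|i]; rewrite coefB coefZ coefXM !coef_narayana /=.
  by rewrite !bin0 subrr mulr0.
rewrite coef_narayana_mean binS !natrM natrD.
have H1 := bin_diagR k i.
apply: (mulfI (natS_neq0 i)).
transitivity ('C(s, i)%:R * (i.+1%:R * 'C(k.+1, i.+1)%:R) : R); first by ring.
rewrite H1; field; rewrite gt_eqF //; have := ler0n R i; lra.
Qed.

(** The increment is proportional to the one in [narayana_diff]; this proportionality makes the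
    difference of consecutive determinants factor. *)
Lemma shifted_narayana_diff s k :
  U k.+1 s.+1 - U k.+1 s = s.+1%:R *: ('X * E s k).
Proof.
apply/polyP => -[|i]; rewrite coefB coefZ [('X * E _ _)`_ _]coefXM /=.
  by rewrite !coef0_shifted_narayana subrr mulr0.
rewrite !coef_shifted_narayana coef_narayana_mean /= binS !natrM natrD.
have H1 := bin_diagR s i.
apply: (mulfI (natS_neq0 i)).
transitivity ('C(k, i)%:R * (i.+1%:R * 'C(s.+1, i.+1)%:R) : R); first by ring.
rewrite H1; field; rewrite gt_eqF //; have := ler0n R i; lra.
Qed.

(** At a zero r < 0 of [E s k] only r (1 - r) E'(r) is left on the right, so the polynomial for k+1
    has the sign opposite to E' there. This drives the induction for real zeros. *)
Lemma narayana_mean_up s k :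
  k.+2%:R *: E s k.+1 =
    k.+2%:R *: E s k + s%:R *: ('X * E s k) + 'X * (1 - 'X) * (E s k)^`().
Proof.
have -> : 'X * (1 - 'X) * (E s k)^`() =
    'X * (E s k)^`() - 'X * ('X * (E s k)^`()) by ring.
apply/polyP => -[|i].
  rewrite !(coefD, coefN, coefZ, coefXM) /= !coef_narayana_mean !bin0.
  by rewrite mulr0 oppr0 !addr0.
rewrite !(coefD, coefN, coefZ, coefXM) /= !coef_deriv.
have -> : (if i == 0%N then 0 else (E s k)`_i.-1.+1 *+ i.-1.+1) =
    i%:R * (E s k)`_i.
  by case: i => [|i] /=; rewrite ?mul0r // mulr_natl.
rewrite !coef_narayana_mean -mulr_natr binS !natrM natrD.
have H1 := bin_leftR s i; have H2 := bin_leftR k i.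
have i0 := natS_neq0 i; have i1 := natS_neq0 i.+1.
have e1 : i.+1%:R = i%:R + 1 :> R by rewrite -natr1.
have e2 : i.+2%:R = i%:R + 2 :> R by rewrite -[i.+2]addn2 natrD.
have e3 : k.+2%:R = k%:R + 2 :> R by rewrite -[k.+2]addn2 natrD.
have -> : 'C(s, i.+1)%:R = (s%:R - i%:R) * 'C(s, i)%:R / i.+1%:R :> R.
  by rewrite -H1 mulrAC mulfV ?mul1r // natS_neq0.
have -> : 'C(k, i.+1)%:R = (k%:R - i%:R) * 'C(k, i)%:R / i.+1%:R :> R.
  by rewrite -H2 mulrAC mulfV ?mul1r // natS_neq0.
rewrite e1 in i0 *; rewrite e2 in i1 *; rewrite e3; field.
by rewrite i0 i1.
Qed.

(** At a zero r of [E s k.+1] this gives r E_{s,k}(r) a sign opposite to E_{s,k+1}'(r), through the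
    square r^2; so x E_{s,k} is interlaced by E_{s,k+1}. *)
Lemma narayana_mean_down s k :
  k.+1%:R *: E s k = k.+1%:R *: E s k.+1 - 'X * (E s k.+1)^`().
Proof.
apply/polyP => i; rewrite !(coefD, coefN, coefZ, coefXM) coef_deriv.
have -> : (if i == 0%N then 0 else (E s k.+1)`_i.-1.+1 *+ i.-1.+1) =
    i%:R * (E s k.+1)`_i.
  by case: i => [|i] /=; rewrite ?mul0r // mulr_natl.
rewrite !coef_narayana_mean !natrM.
have H := bin_downR k i.
transitivity ('C(s, i)%:R / i.+1%:R * (k.+1%:R * 'C(k, i)%:R) : R); first by ring.
by rewrite -H; ring.
Qed.

Lemma narayana_mean_s0 k : E 0 k = 1.
Proof.
apply/polyP => i; rewrite coef_narayana_mean coef1 bin0n.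
by case: i => [|i]; rewrite ?mul0r // bin0 divr1.
Qed.

Lemma size_narayana_mean s k : size (E s k) = (minn s k).+1.
Proof.
apply/eqP; rewrite eqn_leq; apply/andP; split.
  apply/leq_sizeP => i; rewrite coef_narayana_mean gtn_min => /orP [] h.
    by rewrite (bin_small h) mul0r.
  by rewrite (bin_small h) muln0 mul0r.
rewrite ltnNge; apply/negP => /leq_sizeP /(_ _ (leqnn _)) /eqP.
rewrite coef_narayana_mean mulf_eq0 invr_eq0 pnatr_eq0 (negbTE (natS_neq0 _)) orbF.
by rewrite muln_eq0 !eqn0Ngt !bin_gt0 geq_minl geq_minr.
Qed.

Lemma coef_narayana_mean_ge0 s k i : 0 <= (E s k)`_i.
Proof. by rewrite coef_narayana_mean divr_ge0 ?ler0n. Qed.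

End NarayanaField.

Section PositiveCoefs.
Variable R : rcfType.
Implicit Types p q : {poly R}.

Definition pos_poly p : Prop := (forall i, 0 <= p`_i) /\ 0 < p`_0.

Lemma pos_poly_neq0 p : pos_poly p -> p != 0.
Proof. by case=> _ p0; apply: contraTneq p0 => ->; rewrite coef0 ltxx. Qed.

Lemma lead_coef_gt0 p : (forall i, 0 <= p`_i) -> p != 0 -> 0 < lead_coef p.
Proof. by move=> p0 pN0; rewrite lt0r lead_coef_eq0 pN0 lead_coefE p0. Qed.

Lemma pos_poly_horner p x : pos_poly p -> 0 <= x -> 0 < p.[x].
Proof.
move=> pp x0; have := pos_poly_neq0 pp; case: pp => p0 p00.
rewrite -size_poly_gt0 horner_coef; case: (size p) => // m _.
rewrite big_ord_recl expr0 mulr1 ltr_pwDl //.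
by apply: sumr_ge0 => i _; rewrite mulr_ge0 ?exprn_ge0.
Qed.

Lemma pos_polyM p q : pos_poly p -> pos_poly q -> pos_poly (p * q).
Proof.
move=> [p0 p00] [q0 q00]; split; last by rewrite coef0M mulr_gt0.
by move=> i; rewrite coefM sumr_ge0 // => j _; rewrite mulr_ge0.
Qed.

End PositiveCoefs.

Section SimpleRoots.
Variable R : rcfType.
Implicit Types s : seq R.

Lemma uniq_deriv_root_prod s :
  uniq s <-> {in s, forall r, (root_prod s)^`().[r] != 0}.
Proof.
elim: s => [|a l IH] //=.
have tail r : r \in l ->
    (root_prod (a :: l))^`().[r] = (r - a) * (root_prod l)^`().[r].
  move=> rl; rewrite horner_deriv_root_prod_cons.
  have /eqP -> : (root_prod l).[r] == 0 by rewrite horner_root_prod_eq0.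
  by rewrite add0r.
have head : ((root_prod (a :: l))^`().[a] != 0) = (a \notin l).
  by rewrite horner_deriv_root_prod_cons subrr mul0r addr0 -root_root_prod.
split.
  case/andP=> al /IH Hl r; rewrite inE => /predU1P [->|rl]; first by rewrite head.
  rewrite tail // mulf_neq0 ?Hl // subr_eq0.
  by apply: contraNneq al => <-.
move=> H; rewrite -head H ?mem_head //=; apply/IH => r rl.
have := H r; rewrite inE rl orbT tail // mulf_eq0 negb_or => /(_ isT).
by case/andP.
Qed.

End SimpleRoots.

(** * Real zeros of the Narayana means and of the two determinants *)

Section RootedNarayana.
Variable R : rcfType.
Implicit Types s k n i : nat.

Local Notation P := (@narayana R).
Local Notation U := (@shifted_narayana R).
Local Notation E := (@narayana_mean R).

Lemma pos_narayana_mean s k : pos_poly (E s k).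
Proof.
split; first exact: coef_narayana_mean_ge0.
by rewrite coef_narayana_mean !bin0 divr1 ltr01.
Qed.

Lemma lead_narayana_mean_gt0 s k : 0 < lead_coef (E s k).
Proof.
have [h _] := pos_narayana_mean s k.
by apply: lead_coef_gt0 => //; apply: pos_poly_neq0 (pos_narayana_mean s k).
Qed.

Definition neg_simple_split (p : {poly R}) es : Prop :=
  [/\ p = lead_coef p *: root_prod es, uniq es & all (fun z => z < 0) es].

Lemma root_of_split (p : {poly R}) es r :
  p = lead_coef p *: root_prod es -> r \in es -> p.[r] = 0.
Proof.
move=> -> res; rewrite hornerZ.
by have /eqP -> : (root_prod es).[r] == 0; rewrite ?mulr0 ?horner_root_prod_eq0.
Qed.

Lemma deriv_of_split (p : {poly R}) es r :
  p = lead_coef p *: root_prod es ->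
  p^`().[r] = lead_coef p * (root_prod es)^`().[r].
Proof. by move=> pE; rewrite {1}pE derivZ hornerZ. Qed.

Lemma narayana_mean_split s k : exists es, neg_simple_split (E s k) es.
Proof.
elim: k => [|k [es [EE ues nes]]].
  exists [::]; rewrite narayana_mean_sym narayana_mean_s0; split=> //.
  by rewrite lead_coef1 scale1r /root_prod big_nil.
have [||r res|gs [gE ugs _]] := @interlacing_of_signs _ es (E s k.+1) ues.
- exact: lead_narayana_mean_gt0.
- have := congr1 (fun p : {poly R} => size p) EE.
  rewrite size_scale ?lead_coef_eq0 -?size_poly_gt0 ?size_narayana_mean //.
  by rewrite size_root_prod => -[<-]; rewrite !ltnS; lia.
- have r0 : r < 0 by move/allP: nes; apply.
  have lE := lead_narayana_mean_gt0 s k.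
  have := congr1 (fun p => p.[r]) (narayana_mean_up R s k).
  rewrite !(hornerD, hornerZ, hornerM, hornerN, hornerX, hornerC).
  rewrite (root_of_split EE res) (deriv_of_split r EE) !mulr0 !add0r.
  have : (root_prod es)^`().[r] != 0 by move/uniq_deriv_root_prod: ues; apply.
  move: (root_prod es)^`().[r] (E s k.+1).[r] => d e d0 He.
  have k0 : 0 < k.+2%:R :> R by rewrite ltr0n.
  rewrite -(pmulr_rlt0 _ k0) mulrCA He.
  have -> : d * (r * (1 - r) * (lead_coef (E s k) * d))
          = r * ((1 - r) * lead_coef (E s k) * d ^+ 2) by ring.
  have d2 : 0 < d ^+ 2 by rewrite lt0r sqrf_eq0 d0 sqr_ge0.
  by rewrite nmulr_rlt0 //; do 2!apply: mulr_gt0 => //; lra.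
(* Nonnegative coefficients with a positive constant term exclude zeros in [0, oo). *)
exists gs; split=> //; apply/allP => r rgs; rewrite ltNge; apply/negP => r0.
have := pos_poly_horner (pos_narayana_mean s k.+1) r0.
by rewrite (root_of_split gE rgs) ltxx.
Qed.

Lemma size_of_split (p : {poly R}) es :
  p != 0 -> p = lead_coef p *: root_prod es -> size p = (size es).+1.
Proof.
by move=> p0 ->; rewrite size_scale ?lead_coef_eq0 // size_root_prod.
Qed.

Lemma size_XderivE (p : {poly R}) : (size ('X * p^`())%R <= size p)%N.
Proof.
have [->|p0] := eqVneq p 0; first by rewrite deriv0 mulr0 size_poly0.
rewrite mulrC; apply: leq_trans (size_polyMleq _ _) _; rewrite size_polyX addn2 /=.
exact: lt_size_deriv.
Qed.

Lemma size_narayana s k : (size (P s k) <= size (E s k))%N.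
Proof.
rewrite narayana_meanE (leq_trans (size_polyD _ _)) // geq_max leqnn.
exact: size_XderivE.
Qed.

(* [T] is the factor shared by the two determinants. *)
Section CommonFactor.
Variables n k s : nat.
Hypothesis sn : (s < n)%N.
Let K := k.+1.
Let c : R := s.+1%:R / K%:R.
Let g : R := 1 - c * (K.+1%:R / n%:R).
Let T := P n K - c *: U n K.

Let n_gt0 : 0 < n%:R :> R.
Proof. by rewrite ltr0n; case: n sn. Qed.

Let K_gt0 : 0 < K%:R :> R. Proof. by rewrite ltr0n. Qed.

Let c_gt0 : 0 < c. Proof. by rewrite divr_gt0 // ltr0n. Qed.

Lemma shifted_narayanaE : U n K = (K.+1%:R / n%:R) *: ('X * (E n K)^`()).
Proof.
apply: (scalerI (lt0r_neq0 n_gt0)).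
rewrite shifted_narayana_mean ?(leq_ltn_trans _ sn) // scalerA.
by rewrite mulrCA mulfV ?mulr1 ?lt0r_neq0.
Qed.

(** In [g], the 1 comes from P_n and the subtracted part from c U_{n,K}. Its sign is not determined
    by the hypotheses. *)
Lemma common_factorE : T = E n K + g *: ('X * (E n K)^`()).
Proof.
rewrite /T narayana_meanE shifted_narayanaE scalerA -addrA; congr (_ + _).
by rewrite -[X in X - _]scale1r -scalerBl.
Qed.

Lemma coef_common_factor i :
  T`_i = ('C(n, i) * 'C(K, i))%:R / i.+1%:R * (1 + g * i%:R).
Proof.
rewrite common_factorE coefD coefZ coefXM coef_deriv coef_narayana_mean.
case: i => [|i] /=; first by rewrite !mulr0 !addr0 mulr1.
by rewrite coef_narayana_mean -mulr_natr; ring.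
Qed.

(** From (s+1)/n <= 1 one gets K g >= K - (K+1) = -1, with equality when s + 1 = n. *)
Lemma common_factor_weight i :
  K%:R * (1 + g * i%:R) >= K%:R - i%:R.
Proof.
have gK : -1 <= K%:R * g.
  have -> : K%:R * g = K%:R - s.+1%:R / n%:R * K.+1%:R.
    by rewrite /g /c; field; rewrite !lt0r_neq0.
  have : s.+1%:R / n%:R <= 1 :> R by rewrite ler_pdivrMr // mul1r ler_nat.
  have : 0 <= K.+1%:R :> R by rewrite ler0n.
  rewrite -[K.+1%:R]natr1; move: (_ / _) (K%:R) => u v; nra.
have i0 : 0 <= i%:R :> R by rewrite ler0n.
by rewrite mulrDr mulr1 mulrA; nra.
Qed.

Lemma coef_common_factor_ge0 i : 0 <= T`_i.
Proof.
rewrite coef_common_factor; have [iK|Ki] := leqP i K; last first.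
  by rewrite (bin_small Ki) muln0 !mul0r.
rewrite mulr_ge0 ?divr_ge0 ?ler0n // -(pmulr_rge0 _ K_gt0).
by apply: le_trans (common_factor_weight i); rewrite subr_ge0 ler_nat.
Qed.

Lemma pos_common_factor : pos_poly T.
Proof.
split; first exact: coef_common_factor_ge0.
by rewrite coef_common_factor !bin0 mulr0 addr0 mulr1 divr1 ltr01.
Qed.

Lemma lead_common_factor_gt0 : 0 < lead_coef T.
Proof.
apply: lead_coef_gt0; first exact: coef_common_factor_ge0.
exact: pos_poly_neq0 pos_common_factor.
Qed.

(** When s + 1 = n and K <= n the factor 1 + g K kills the top coefficient of T. The coefficient
    just below it has positive weight, so at most one degree is lost. *)
Lemma size_common_factor : (size T <= size (E n K) <= (size T).+1)%N.
Proof.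
apply/andP; split.
  rewrite common_factorE (leq_trans (size_polyD _ _)) // geq_max leqnn.
  by rewrite (leq_trans (size_scale_leq _ _)) // size_XderivE.
rewrite size_narayana_mean ltnS.
case mE : (minn n K) => [|m] //.
have [mn mK] : (m < n)%N /\ (m < K)%N by split; lia.
rewrite ltnNge; apply/negP => /leq_sizeP /(_ _ (leqnn _)) /eqP.
rewrite coef_common_factor !mulf_eq0 invr_eq0 !pnatr_eq0 muln_eq0 !eqn0Ngt.
rewrite !bin_gt0 !(ltnW mn) (ltnW mK) /= => /eqP w0.
have := common_factor_weight m; rewrite w0 mulr0 subr_le0 ler_nat.
by rewrite leqNgt mK.
Qed.

(** Adding a multiple of x E_n' to E_n does not change the Wronskian with x E_n'. *)
Lemma wronskian_common_factor_gt0 x :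
  0 < (wronskian T ('X * (E n K)^`())).[x].
Proof.
have [en [EE uen nen]] := narayana_mean_split n K.
have -> : wronskian T ('X * (E n K)^`()) = wronskian (E n K) ('X * (E n K)^`()).
  by rewrite /wronskian common_factorE derivD derivZ -!mul_polyC; ring.
have -> : wronskian (E n K) ('X * (E n K)^`()) = lead_coef (E n K) ^+ 2 *:
    wronskian (root_prod en) ('X * (root_prod en)^`()).
  move: (lead_coef _) EE => a ->.
  by rewrite /wronskian !derivM !derivZ derivX -!mul_polyC; ring.
have lE := lead_narayana_mean_gt0 n K.
rewrite hornerZ mulr_gt0 ?exprn_gt0 // wronskian_root_prod_gt0 //.
have := size_of_split _ EE.
rewrite size_narayana_mean -lead_coef_eq0 gt_eqF // => /(_ isT) [].
by move=> szE; rewrite -size_eq0 -szE; lia.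
Qed.

Lemma common_factor_split : exists ts,
  [/\ T = lead_coef T *: root_prod ts, uniq ts &
      {in ts, forall r, (root_prod ts)^`().[r] * (U n K).[r] < 0}].
Proof.
have [en [EE uen nen]] := narayana_mean_split n K.
have lE := lead_narayana_mean_gt0 n K.
have E0 : E n K != 0 by rewrite -lead_coef_eq0 gt_eqF.
have szE := size_of_split E0 EE.
have /andP [sT _] := size_common_factor.
have T0 := pos_poly_neq0 pos_common_factor.
have at_root r : r \in en ->
    T.[r] = g * (r * (lead_coef (E n K) * (root_prod en)^`().[r])).
  move=> ren; rewrite common_factorE hornerD (root_of_split EE ren) add0r.
  by rewrite hornerZ hornerM hornerX (deriv_of_split r EE).
(* The sign [e] compensates that of [g]: since the zeros of E_n are negative, [e *: T] has the sign
   of E_n' at each of them. The case g = 0 is treated apart, as T = E_n then. *)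
have signs (e : R) : e * g < 0 ->
    {in en, forall r, 0 < (root_prod en)^`().[r] * (e *: T).[r]}.
  move=> eg r ren; rewrite hornerZ at_root //.
  have : (root_prod en)^`().[r] != 0 by move/uniq_deriv_root_prod: uen; apply.
  move: (root_prod en)^`().[r] => d d0.
  have r0 : r < 0 by move/allP: nen; apply.
  have d2 : 0 < d ^+ 2 by rewrite lt0r sqrf_eq0 d0 sqr_ge0.
  have -> : d * (e * (g * (r * (lead_coef (E n K) * d))))
          = (e * g) * (r * (lead_coef (E n K) * d ^+ 2)) by ring.
  by rewrite nmulr_rgt0 // nmulr_rlt0 // mulr_gt0.
have scaled (e : R) : e != 0 -> e * g < 0 ->
    exists ts, T = lead_coef T *: root_prod ts.
  move=> e0 eg; have [||ts tsE] := @split_of_signs _ en (e *: T) uen _ _ (signs e eg).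
  - by rewrite scaler_eq0 negb_or e0.
  - by rewrite size_scale // -szE.
  exists ts; apply: (scalerI e0).
  by rewrite {1}tsE lead_coefZ scalerA.
have [ts TE] : exists ts, T = lead_coef T *: root_prod ts.
  case: (ltrgt0P g) => g0.
  - by apply: (scaled (-1)); rewrite ?mulN1r ?oppr_lt0 // oppr_eq0 oner_eq0.
  - by apply: (scaled 1); rewrite ?mul1r // oner_eq0.
  - by exists en; rewrite common_factorE g0 scale0r addr0.
have lT := lead_common_factor_gt0.
(* At a zero of T the positive Wronskian is minus T' times x E_n'. This gives both simplicity of the
   zero and the sign of U there. *)
have neg r : r \in ts -> (root_prod ts)^`().[r] * ('X * (E n K)^`()).[r] < 0.
  move=> rts; have := wronskian_common_factor_gt0 r.
  rewrite /wronskian hornerD hornerN !hornerM (root_of_split TE rts) mul0r add0r.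
  by rewrite (deriv_of_split r TE) oppr_gt0 -mulrA pmulr_rlt0 // hornerM.
exists ts; split=> // [|r rts].
  apply/uniq_deriv_root_prod => r /neg.
  by apply: contraTneq => ->; rewrite mul0r ltxx.
rewrite shifted_narayanaE hornerZ mulrCA pmulr_rlt0 ?neg //.
by rewrite divr_gt0 // ltr0n.
Qed.

Theorem determinants_interlacing
    (L := P n K * P s K - U n K * U K s)
    (M := P n K * (P s.+1 K - P s K) - U n K * (U K s.+1 - U K s)) :
  exists ls ms, [/\ exists2 a, a != 0 & L = a *: root_prod ls,
    exists2 a, a != 0 & M = a *: root_prod ms &
    forall t, (count_ge t ls <= (count_ge t ms).+1)%N /\
              (count_ge t ms <= (count_ge t ls).+1)%N].
Proof.
have [es [EE ues nes]] := narayana_mean_split s K.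
have [ts [TE uts Tsign]] := common_factor_split.
have lE := lead_narayana_mean_gt0 s K; have lT := lead_common_factor_gt0.
have E0 : E s K != 0 by rewrite -lead_coef_eq0 gt_eqF.
have T0 : T != 0 by rewrite -lead_coef_eq0 gt_eqF.
have K0 : K%:R != 0 :> R by rewrite lt0r_neq0.
have UsE : U K s = c *: (P s K - E s K).
  apply: (scalerI K0); rewrite shifted_narayana_mean // narayana_mean_sym.
  rewrite narayana_meanE [_ + _ - _]addrAC subrr add0r scalerA.
  by rewrite mulrCA mulfV // mulr1.
have LE : L = P s K * T + (c *: U n K) * E s K.
  by rewrite /L /T UsE -!mul_polyC; ring.
have ME : M = (K%:R *: ('X * E s k)) * T.
  rewrite /M narayana_diff shifted_narayana_diff /T.
  have -> : s.+1%:R *: ('X * E s k) = c *: (K%:R *: ('X * E s k)).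
    by rewrite scalerA divfK.
  by rewrite -!mul_polyC; ring.
have Uge0 i : 0 <= (U n K)`_i.
  by case: i => [|i]; rewrite ?coef0_shifted_narayana ?coef_shifted_narayana.
have Pge0 : pos_poly (P s K).
  by split=> [i|]; rewrite coef_narayana ?bin0.
have posL : pos_poly L.
  have [PT PT0] := pos_polyM Pge0 pos_common_factor.
  have UE i : 0 <= ((c *: U n K) * E s K)`_i.
    rewrite coefM sumr_ge0 // => j _.
    apply: mulr_ge0; last exact: coef_narayana_mean_ge0.
    by rewrite coefZ mulr_ge0 // ltW.
  by rewrite LE; split=> [i|]; rewrite coefD ?addr_ge0 // ltr_wpDr.
have es_sign (r : R) : r \in es -> r < 0 /\ 0 < (root_prod es)^`().[r] ^+ 2.
  move=> res; split; first by move/allP: nes; apply.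
  by rewrite lt0r sqrf_eq0 sqr_ge0 andbT; move/uniq_deriv_root_prod: ues; apply.
have sE := size_of_split E0 EE; have sT := size_of_split T0 TE.
pose p := lead_coef T *: P s K; pose u := (c * lead_coef (E s K)) *: U n K.
have LE' : L = p * root_prod ts + u * root_prod es.
  by rewrite LE {1}TE {1}EE /p /u -!mul_polyC; ring.
have [||||ls lsE Hls] := @interlacing_of_sum _ es ts p u ues uts.
- move=> r res; have [r0 d2] := es_sign r res.
  rewrite /p hornerZ narayana_meanE hornerD (root_of_split EE res) add0r.
  rewrite hornerM hornerX (deriv_of_split r EE).
  move: (root_prod es)^`().[r] d2 => d d2.
  have -> : d * (lead_coef T * (r * (lead_coef (E s K) * d))) =
     r * (lead_coef T * (lead_coef (E s K) * d ^+ 2)) by ring.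
  by rewrite nmulr_rlt0 //; do 2!apply: mulr_gt0 => //.
- move=> r rts; rewrite /u hornerZ mulrCA pmulr_rlt0 ?Tsign //.
  exact: mulr_gt0.
- rewrite -LE'; apply: lead_coef_gt0; last exact: pos_poly_neq0.
  by case: posL.
- rewrite -LE' LE (leq_trans (size_polyD _ _)) // geq_max; apply/andP; split.
    apply: leq_trans (size_polyMleq _ _) _.
    have := size_narayana s K; rewrite sE sT addnS /= => sP.
    by rewrite (leq_trans (leq_add sP (leqnn _))) // addSn.
  (* The degree of U may exceed that of T by one when T has lost its top coefficient; this still
     fits the allowed excess of one zero. *)
  apply: leq_trans (size_polyMleq _ _) _.
  have sU : (size (c *: U n K)%R <= size (E n K))%N.
    rewrite shifted_narayanaE scalerA (leq_trans (size_scale_leq _ _)) //.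
    exact: size_XderivE.
  have {}sU : (size (c *: U n K)%R <= (size ts).+2)%N.
    by rewrite -sT (leq_trans sU) //; case/andP: size_common_factor.
  by rewrite sE addnS /= (leq_trans (leq_add sU (leqnn _))) // !addSn addnC.
have lXE : lead_coef ('X * E s k) = lead_coef (E s k).
  by rewrite mulrC lead_coefMX.
have [||r res|qs [qsE _ Hqs]] := @interlacing_of_signs _ es ('X * E s k) ues.
- by rewrite lXE lead_narayana_mean_gt0.
- rewrite mulrC size_mulX -?lead_coef_eq0 ?gt_eqF ?lead_narayana_mean_gt0 //.
  by move: sE; rewrite !size_narayana_mean => -[<-]; rewrite !ltnS /K; clear; lia.
- have [r0 d2] := es_sign r res.
  have := congr1 (fun p => p.[r]) (narayana_mean_down R s k).
  rewrite !(hornerD, hornerZ, hornerM, hornerN, hornerX, hornerC).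
  rewrite (root_of_split EE res) (deriv_of_split r EE) mulr0 add0r.
  move: (root_prod es)^`().[r] (E s k).[r] d2 => d e d2 He.
  rewrite -(pmulr_rlt0 _ K_gt0).
  have -> : K%:R * (d * (r * e)) = d * r * (K%:R * e) by ring.
  rewrite He.
  have -> : d * r * - (r * (lead_coef (E s K) * d)) =
     - (lead_coef (E s K) * (r ^+ 2 * d ^+ 2)) by ring.
  rewrite oppr_lt0 mulr_gt0 // mulr_gt0 //.
  by rewrite lt0r sqrf_eq0 sqr_ge0 andbT ltr0_neq0.
exists ls, (qs ++ ts); split.
- exists (lead_coef L); last by rewrite LE'.
  by rewrite lead_coef_eq0 pos_poly_neq0.
- exists (K%:R * lead_coef ('X * E s k) * lead_coef T).
    by rewrite !mulf_neq0 // lt0r_neq0 // lXE lead_narayana_mean_gt0.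
  rewrite ME {1}qsE {1}TE root_prod_cat -!mul_polyC !rmorphM /=; ring.
(* Both counts equal that of [es ++ ts] or exceed it by one, hence they differ by at most one. *)
move=> t; have := Hls t; have := Hqs t; rewrite !count_ge_cat.
move: (count_ge t ls) (count_ge t qs) (count_ge t es) (count_ge t ts) => x y z w.
by clear; lia.
Qed.

End CommonFactor.
End RootedNarayana.

(** * From root counts to common interleavers *)

Section CommonInterleaver.
Variable R : realType.
Implicit Types (s ls ms hs : seq R) (p q : {poly R}).

Lemma real_rooted_split a s : a != 0 -> real_rooted (a *: root_prod s).
Proof.
move=> a0; split; first by rewrite scaler_eq0 negb_or a0 root_prod_neq0.
move=> z; rewrite map_polyZ rootZ ?fmorph_eq0 // /root_prod rmorph_prod /=.
under eq_bigr do rewrite rmorphB /= map_polyX map_polyC.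
rewrite -(big_map (real_complex R) xpredT (fun w => 'X - w%:P)).
rewrite root_prod_XsubC => /mapP [x _ ->].
by rewrite complex_real.
Qed.

Lemma zero_list_split a s :
  a != 0 -> sorted >=%R s -> zero_list (a *: root_prod s) s.
Proof.
move=> a0 ss; split=> // x.
rewrite -mul_polyC mupMr ?mu_prod_XsubC //.
by rewrite rootC.
Qed.

Lemma count_ge_sorted s t i : sorted >=%R s ->
  (i < count_ge t s)%N = (i < size s)%N && (t <= s`_i).
Proof.
elim: s i => [|a s IH] i //= ps.
have sa : all (fun z => z <= a) s.
  by apply: order_path_min ps; apply: rev_trans le_trans.
have ss := path_sorted ps.
case: (leP t a) => ta.
  case: i => [|i] /=; first by rewrite ta.
  by rewrite add1n ltnS IH.
have -> : count_ge t s = 0%N.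
  apply/eqP; rewrite -leqn0 leqNgt -has_count -all_predC.
  by apply: sub_all sa => z za /=; rewrite -ltNge (le_lt_trans za ta).
rewrite addn0 ltn0; apply/esym/negbTE; rewrite negb_and -ltNge.
case: i => [|i] /=; first by rewrite ta.
rewrite ltnS; case: ltnP => //= si.
by apply: le_lt_trans ta; move/allP: sa; apply; apply: mem_nth.
Qed.

(** Take t to be the entry of [ls] at index i+1: at least i+2 entries of [ls] reach it, hence at
    least i+1 entries of [ms]. *)
Lemma count_le_nth ls ms i : sorted >=%R ls -> sorted >=%R ms ->
    (forall t, (count_ge t ls <= (count_ge t ms).+1)%N) ->
  (i.+1 < size ls)%N -> (i < size ms)%N /\ ls`_i.+1 <= ms`_i.
Proof.
move=> sl sm H il; have := H (ls`_i.+1).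
have : (i.+1 < count_ge (ls`_i.+1)%R ls)%N by rewrite count_ge_sorted // il lexx.
move=> h1 h2; have : (i < count_ge (ls`_i.+1)%R ms)%N by rewrite -ltnS (leq_trans h1).
by rewrite count_ge_sorted // => /andP.
Qed.

Lemma interlaces_split a b ls hs : a != 0 -> b != 0 ->
    sorted >=%R ls -> sorted >=%R hs -> (size ls <= size hs <= (size ls).+1)%N ->
    (forall i, (i < size ls)%N -> ls`_i <= hs`_i) ->
    (forall i, (i.+1 < size hs)%N -> hs`_i.+1 <= ls`_i) ->
  interlaces (a *: root_prod ls) (b *: root_prod hs).
Proof.
move=> a0 b0 sl sh sz H1 H2; split; try exact: real_rooted_split.
  by rewrite !size_scale // !size_root_prod.
by exists ls, hs; split=> //; apply: zero_list_split.
Qed.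

Lemma common_interleaver_of_count a b ls ms : a != 0 -> b != 0 ->
    (forall t, (count_ge t ls <= (count_ge t ms).+1)%N /\
               (count_ge t ms <= (count_ge t ls).+1)%N) ->
  exists h, common_interleaver (a *: root_prod ls) (b *: root_prod ms) h.
Proof.
move=> a0 b0 Hc.
have decr s : exists2 s', sorted >=%R s' & perm_eq s s'.
  exists (sort >=%R s); last by rewrite perm_sym perm_sort.
  by apply: sort_sorted => x y; apply: le_total.
have [ls' sl pl] := decr ls; have [ms' sm pm] := decr ms.
rewrite (perm_root_prod pl) (perm_root_prod pm).
have {Hc pl pm} : forall t, (count_ge t ls' <= (count_ge t ms').+1)%N /\
               (count_ge t ms' <= (count_ge t ls').+1)%N.
  by move=> t; rewrite -(perm_count_ge t pl) -(perm_count_ge t pm).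
move: ls' ms' sl sm => {}ls {}ms sl sm Hc.
wlog sz : a b ls ms a0 b0 sl sm Hc / (size ms <= size ls)%N.
  move=> W; case/orP: (leq_total (size ms) (size ls)) => sz; first exact: W.
  have [|h [H1 H2 H3]] := W b a ms ls b0 a0 sm sl _ sz; last by exists h.
  by move=> t; case: (Hc t).
have Hlm i : (i.+1 < size ls)%N -> (i < size ms)%N /\ ls`_i.+1 <= ms`_i.
  by apply: count_le_nth => // t; case: (Hc t).
have Hml i : (i.+1 < size ms)%N -> (i < size ls)%N /\ ms`_i.+1 <= ls`_i.
  by apply: count_le_nth => // t; case: (Hc t).
have sz' : (size ls <= (size ms).+1)%N.
  by case: (size ls) Hlm => [|[|m]] // /(_ m (leqnn _)) [].
have nth_sorted s i : sorted >=%R s -> (i.+1 < size s)%N -> s`_i.+1 <= s`_i.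
  by move=> /sortedP; apply.
(* [ls] is the longer list, by at most one entry. Past the end of [ms] the default value 0 of [nth]
   would spoil the maximum, so the entry of [ls] is taken there. *)
pose hs := mkseq (fun i => Num.max ls`_i
  (if (i < size ms)%N then ms`_i else ls`_i)) (size ls).
have szh : size hs = size ls by rewrite size_mkseq.
have nth_hs i : (i < size ls)%N ->
    hs`_i = Num.max ls`_i (if (i < size ms)%N then ms`_i else ls`_i).
  exact: nth_mkseq.
have hl i : (i < size ls)%N -> ls`_i <= hs`_i.
  by move=> il; rewrite nth_hs // le_max lexx.
have lh i : (i.+1 < size ls)%N -> hs`_i.+1 <= ls`_i.
  move=> il; rewrite nth_hs // ge_max nth_sorted //=.
  by case: ifP => [im|_]; [case: (Hml i im) | apply: nth_sorted].
have sh : sorted >=%R hs.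
  apply/(sortedP 0) => i; rewrite szh => il.
  by apply: le_trans (lh _ il) (hl _ (ltnW il)).
exists (1 *: root_prod hs); split.
- by apply: real_rooted_split; apply: oner_neq0.
- by apply: interlaces_split; rewrite ?oner_neq0 // szh ?leqnn ?leqnSn.
apply: interlaces_split; rewrite ?oner_neq0 ?szh ?sz ?sz' // => i im.
  by rewrite (nth_hs i (leq_trans im sz)) im le_max lexx orbT.
rewrite nth_hs // ge_max; case: (Hlm i im) => _ -> /=.
by case: ifP => [im'|_]; [apply: nth_sorted | case: (Hlm i im)].
Qed.

End CommonInterleaver.

(** * Transfer polynomials of [2] x [n] *)

Section TransferStep.
Context {d : Order.disp_t} {Q : finPOrderType d}.
Implicit Types I J : {set Q}.

Definition extend_chain k (c : {ffun 'I_k.+1 -> {set Q}}) I :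
    {ffun 'I_k.+2 -> {set Q}} :=
  [ffun i => if unlift ord_max i is Some j then c j else I].

Lemma extend_chain_lt k (c : {ffun 'I_k.+1 -> {set Q}}) I
    (i : 'I_k.+2) (j : 'I_k.+1) :
  i = j :> nat -> extend_chain c I i = c j.
Proof.
move=> ij; have -> : i = lift ord_max j.
  by apply: val_inj; rewrite /= /bump leqNgt ltn_ord.
by rewrite ffunE liftK.
Qed.

Lemma extend_chain_max k (c : {ffun 'I_k.+1 -> {set Q}}) I (i : 'I_k.+2) :
  i = k.+1 :> nat -> extend_chain c I i = I.
Proof.
move=> ij; have -> : i = ord_max by apply: val_inj.
by rewrite ffunE unlift_none.
Qed.

Lemma extend_chain_lift k (c : {ffun 'I_k.+1 -> {set Q}}) I (j : 'I_k) :
  extend_chain c I (lift ord0 (widen_ord (leqnSn k) j)) = c (lift ord0 j).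
Proof. exact: extend_chain_lt. Qed.

Lemma extend_chain_widen k (c : {ffun 'I_k.+1 -> {set Q}}) I (j : 'I_k.+1) :
  extend_chain c I (widen_ord (leqnSn k.+1) j) = c j.
Proof. exact: extend_chain_lt. Qed.

Lemma chain_weight_extend k (c : {ffun 'I_k.+1 -> {set Q}}) I :
  chain_weight (extend_chain c I) =
    (chain_weight c + #|max_set I :\: c ord_max|)%N.
Proof.
rewrite /chain_weight big_ord_recr /= extend_chain_widen extend_chain_max //.
congr (_ + _)%N; apply: eq_bigr => j _.
by rewrite extend_chain_lift extend_chain_widen.
Qed.

Lemma ideal_chain_extend k (c : {ffun 'I_k.+1 -> {set Q}}) I : is_ideal I ->
  ideal_chain I (extend_chain c I) =
    ideal_chain (c ord_max) c && (c ord_max \subset I).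
Proof.
move=> idI; rewrite /ideal_chain eqxx.
rewrite (@extend_chain_lt _ _ _ ord0 ord0) // (@extend_chain_max _ _ _ ord_max) //.
rewrite eqxx /=; apply/and3P/andP.
  case=> /forallP idc c0 /forallP sc; split; last first.
    have := sc ord_max.
    by rewrite extend_chain_widen (@extend_chain_max _ _ _ (lift ord0 _)).
  apply/and3P; split=> //; apply/forallP => j.
    by have := idc (lift ord_max j); rewrite ffunE liftK.
  have := sc (widen_ord (leqnSn k) j).
  by rewrite extend_chain_lift extend_chain_widen.
case=> /and3P [/forallP idc c0 /forallP sc] cI; split=> //; apply/forallP => j.
  by rewrite ffunE; case: unlift.
rewrite extend_chain_widen; have [jk|kj] := ltnP j k.
  have -> : j = widen_ord (leqnSn k) (Ordinal jk) by apply: val_inj.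
  by rewrite extend_chain_lift.
have -> : j = ord_max by apply: val_inj; apply/eqP; rewrite eqn_leq kj -ltnS ltn_ord.
by rewrite (@extend_chain_max _ _ _ (lift ord0 _)).
Qed.

(** The last proper step of the chain is removed and the chains are grouped by the ideal J preceding
    I; only the exponent of that step depends on I. *)
Lemma transfer_polyS (R : nzRingType) k I : is_ideal I ->
  transfer_poly R k.+1 I =
    \sum_(J | is_ideal J && (J \subset I))
      'X^#|max_set I :\: J| * transfer_poly R k J.
Proof.
move=> idI; rewrite /transfer_poly.
pose restr (c : {ffun 'I_k.+2 -> {set Q}}) : {ffun 'I_k.+1 -> {set Q}} :=
  [ffun j => c (lift ord_max j)].
rewrite (reindex_onto (fun c => extend_chain c I) restr) /=; last first.
  move=> c /and4P [_ _ /eqP cI _]; apply/ffunP => i; rewrite ffunE.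
  by case: unliftP => [j|] ->; rewrite ?ffunE.
rewrite (eq_bigl (fun c : {ffun 'I_k.+1 -> {set Q}} =>
  ideal_chain (c ord_max) c && (c ord_max \subset I))); last first.
  move=> c; rewrite ideal_chain_extend // andbC.
  by have -> : restr (extend_chain c I) = c;
    [apply/ffunP => j; rewrite !ffunE liftK | rewrite eqxx].
rewrite (partition_big (fun c : {ffun 'I_k.+1 -> {set Q}} => c ord_max)
  (fun J => is_ideal J && (J \subset I))) /=; last first.
  by move=> c /andP [/and4P [/forallP idc _ _ _] ->]; rewrite idc.
apply: eq_bigr => J /andP [idJ JI]; rewrite big_distrr /=.
apply: eq_big => [c|c /andP [_ /eqP <-]].
  apply/andP/idP => [[/andP [cc _] /eqP <-] //|cJ].
  have /and4P [_ _ /eqP cJ' _] := cJ.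
  by rewrite cJ' cJ JI eqxx.
by rewrite chain_weight_extend exprD commr_polyXn.
Qed.

Lemma transfer_poly0 (R : nzRingType) I : is_ideal I ->
  transfer_poly R 0 I = (I == set0)%:R.
Proof.
move=> idI; rewrite /transfer_poly.
rewrite (eq_bigr (fun _ => 1)) => [|c _]; last by rewrite /chain_weight big_ord0.
have [I0|I0] := eqVneq I set0; last first.
  rewrite big_pred0 // => c; apply/negP => /and4P [_ /eqP c0 /eqP c1 _].
  by move: I0; rewrite -c1 -c0 (_ : ord_max = ord0) ?eqxx //; apply: val_inj.
rewrite (big_pred1 [ffun=> I]) // => c; apply/idP/eqP => [/and4P [_ _ /eqP c1 _]|->].
  by apply/ffunP => i; rewrite ffunE -c1; congr (c _); rewrite (ord1 i) (ord1 ord_max).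
apply/and4P; split; rewrite ?ffunE ?I0 //.
  by apply/forallP => i; rewrite ffunE -I0.
by apply/forallP => -[].
Qed.

End TransferStep.

(** * Ideals of [2] x [n] and the recursion for their transfer polynomials *)

Section Chain2Ideals.
Variable n : nat.
Implicit Types (x y : chain2 n) (I J : {set chain2 n}) (a b : nat).

Lemma le_chain2 x y :
  (x <= y)%O = (x.1 <= y.1)%N && (x.2 <= y.2)%N.
Proof. by []. Qed.

Lemma lt_chain2 x y :
  (x < y)%O = [&& (x.1 <= y.1)%N, (x.2 <= y.2)%N & x != y].
Proof. by rewrite lt_neqAle le_chain2 andbC andbA. Qed.

Lemma ord2_cases (i : 'I_2) : i = ord0 \/ i = ord_max.
Proof. by case: i => -[|[|//]] p; [left|right]; apply: val_inj. Qed.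

Lemma mem_ideal_ab a b x :
  (x \in ideal_ab n a b) = (x.2 < (if x.1 == ord0 then b else a))%N.
Proof.
case: x => i j; rewrite !inE /=.
by case: (ord2_cases i) => ->; rewrite /= ?orbF.
Qed.

Lemma is_ideal_ab a b : (a <= b)%N -> is_ideal (ideal_ab n a b).
Proof.
move=> ab; apply/forallP => x; apply/forallP => y; apply/implyP.
rewrite le_chain2 !mem_ideal_ab => /andP [/andP [xy1 xy2]].
move: xy1 xy2; case: x y => i j [i' j'] /=.
by case: (ord2_cases i) => ->; case: (ord2_cases i') => -> //=; lia.
Qed.

Lemma subset_ideal_ab a b a' b' : (a' <= n)%N -> (b' <= n)%N ->
  (ideal_ab n a' b' \subset ideal_ab n a b) = (a' <= a)%N && (b' <= b)%N.
Proof.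
move=> a'n b'n; apply/subsetP/andP => [H|[aa bb] x].
  split; rewrite leqNgt; apply/negP => h.
    have hn := leq_trans h a'n.
    have := H ((ord_max : 'I_2), Ordinal hn); rewrite !mem_ideal_ab /=.
    by rewrite ltnn h => /(_ isT).
  have hn := leq_trans h b'n.
  have := H ((ord0 : 'I_2), Ordinal hn); rewrite !mem_ideal_ab /=.
  by rewrite ltnn h => /(_ isT).
by rewrite !mem_ideal_ab => /leq_trans; apply; case: ifP.
Qed.

Definition row_length J (i : 'I_2) : nat :=
  \max_(j : 'I_n | ((i, j) : chain2 n) \in J) j.+1.

Lemma row_length_le J i : (row_length J i <= n)%N.
Proof. by apply/bigmax_leqP => j _; apply: ltn_ord. Qed.

Lemma mem_row_length J i (j : 'I_n) : is_ideal J ->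
  (((i, j) : chain2 n) \in J) = (j < row_length J i)%N.
Proof.
move=> idJ; apply/idP/idP => [ijJ|].
  exact: (@leq_bigmax_cond _ _ (fun j : 'I_n => j.+1) j ijJ).
rewrite /row_length => jm.
have c0 : (0 < #|[pred j : 'I_n | ((i, j) : chain2 n) \in J]|)%N.
  rewrite lt0n; apply: contraTneq jm => c0.
  rewrite big_pred0 // => j'; apply: negbTE; apply/negP => h.
  by have /card0_eq /(_ j') := c0; rewrite inE h.
have [j' j'J E] := @eq_bigmax_cond _ _ (fun j : 'I_n => j.+1) c0.
move: jm.
rewrite (eq_bigl (mem [pred j : 'I_n | ((i, j) : chain2 n) \in J])) // E => jj.
move/forallP: idJ => /(_ (i, j)) /forallP /(_ (i, j')) /implyP; apply.
by rewrite le_chain2 leqnn -ltnS jj.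
Qed.

Lemma ideal_chain2 J : is_ideal J ->
  J = ideal_ab n (row_length J ord_max) (row_length J ord0).
Proof.
move=> idJ; apply/setP => -[i j]; rewrite mem_ideal_ab mem_row_length //=.
by case: (ord2_cases i) => ->.
Qed.

Lemma row_length_mono J : is_ideal J ->
  (row_length J ord_max <= row_length J ord0)%N.
Proof.
move=> idJ; apply/bigmax_leqP => j; move=> jJ; rewrite -mem_row_length //.
move/forallP: idJ => /(_ (ord0, j)) /forallP /(_ (ord_max, j)) /implyP; apply.
by rewrite le_chain2 leqnn.
Qed.

Lemma row_length_ab a b i : (a <= n)%N -> (b <= n)%N ->
  row_length (ideal_ab n a b) i = if i == ord0 then b else a.
Proof.
move=> an bn; set m := if _ then _ else _.
have mn : (m <= n)%N by rewrite /m; case: ifP.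
rewrite /row_length (eq_bigl (fun j : 'I_n => (j < m)%N)); last first.
  by move=> j; rewrite mem_ideal_ab.
apply/eqP; rewrite eqn_leq; apply/andP; split; first by apply/bigmax_leqP.
case: m mn => // m mn.
exact: (@leq_bigmax_cond _ (fun j : 'I_n => (j < m.+1)%N)
  (fun j : 'I_n => j.+1) (Ordinal mn)).
Qed.

Lemma card_level_set (i : 'I_2) m (C : bool) : (C -> 0 < m <= n)%N ->
  #|[set x : chain2 n | [&& C, x.1 == i & x.2.+1 == m :> nat]]| = C.
Proof.
case: C => [/(_ isT)|_]; last first.
  by apply/eqP; rewrite cards_eq0; apply/eqP/setP => x; rewrite !inE.
case: m => // m mn; apply/eqP/cards1P; exists (i, Ordinal mn).
apply/setP => -[i' j]; rewrite !inE /= eqSS.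
by rewrite -[in RHS]pair_eqE.
Qed.

(** A new maximal element is the end of a row that has grown. For a = b the end of the first row
    lies below that of the second, whence the extra condition [a < b]. *)
Lemma max_set_ab a b a' b' :
    (a <= b)%N -> (b <= n)%N -> (a' <= a)%N -> (b' <= b)%N -> (a' <= b')%N ->
  max_set (ideal_ab n a b) :\: ideal_ab n a' b' =
    [set x : chain2 n | [&& (a' < a)%N, x.1 == ord_max & x.2.+1 == a :> nat]] :|:
    [set x : chain2 n |
      [&& (b' < b)%N && (a < b)%N, x.1 == ord0 & x.2.+1 == b :> nat]].
Proof.
move=> ab bn aa bb ab'; have an := leq_trans ab bn.
apply/setP => -[i j]; rewrite in_setD mem_ideal_ab /max_set in_set mem_ideal_ab.
rewrite in_setU in_set in_set /= -leqNgt.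
apply/and3P/idP => [[jI' jI /forallP Hmax]|].
  have Hm (i' : 'I_2) (j' : 'I_n) : (j' < (if i' == ord0 then b else a))%N ->
     ~~ [&& (i <= i')%N, (j <= j')%N & ((i, j) : chain2 n) != (i', j')].
    by move=> h; have := Hmax (i', j'); rewrite mem_ideal_ab h lt_chain2.
  case: (ord2_cases i) Hm jI jI' => -> /= Hm jI jI'.
    have ltab : (a < b)%N.
      rewrite ltnNge; apply/negP => ba.
      have := Hm ord_max j; rewrite /= (leq_trans jI ba) leqnn => /(_ isT).
      by [].
    rewrite ltab (leq_ltn_trans jI' jI) !andbT andbF /=.
    rewrite eqn_leq jI /= leqNgt; apply/negP => jb.
    have := Hm ord0 (Ordinal (leq_trans jb bn)) jb; rewrite /= leqnSn /=.
    by rewrite negbK => /eqP [] /(congr1 val) /=; lia.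
  rewrite (leq_ltn_trans jI' jI) !andbF orbF /=.
  rewrite eqn_leq jI /= leqNgt; apply/negP => ja.
  have := Hm ord_max (Ordinal (leq_trans ja an)) ja; rewrite /= leqnSn /=.
  by rewrite negbK => /eqP [] /(congr1 val) /=; lia.
case/orP => [/and3P [aa' /eqP -> /eqP ja]|/and3P [/andP [bb' ltab] /eqP -> /eqP jb]].
  rewrite /= in ja; split.
  - by change (a' <= j)%N; rewrite -ltnS ja.
  - by change (j < a)%N; rewrite -ja.
  apply/forallP => -[i' j']; apply/implyP; rewrite mem_ideal_ab /= => j'a.
  rewrite lt_chain2; apply/negP => /and3P [/= i'i jj /negP ne]; apply: ne.
  case: (ord2_cases i') i'i j'a => -> //= _; rewrite -ja ltnS => j'j.
  by rewrite (_ : j = j') //; apply: val_inj; apply/eqP; rewrite eqn_leq j'j andbT.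
rewrite /= in jb; split.
- by change (b' <= j)%N; rewrite -ltnS jb.
- by change (j < b)%N; rewrite -jb.
apply/forallP => -[i' j']; apply/implyP; rewrite mem_ideal_ab /= => j'a.
rewrite lt_chain2; apply/negP => /and3P [/= i'i jj /negP ne]; apply: ne.
case: (ord2_cases i') i'i j'a => -> //= _.
  rewrite -jb ltnS => j'j.
  by rewrite (_ : j = j') //; apply: val_inj; apply/eqP; rewrite eqn_leq j'j andbT.
by move=> j'a; lia.
Qed.

Lemma card_max_set_ab a b a' b' :
    (a <= b)%N -> (b <= n)%N -> (a' <= a)%N -> (b' <= b)%N -> (a' <= b')%N ->
  #|max_set (ideal_ab n a b) :\: ideal_ab n a' b'| =
    ((a' < a) + ((b' < b) && (a < b)))%N.
Proof.
move=> ab bn aa bb ab'; rewrite max_set_ab // cardsU.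
set A := [set x | _]; set B := [set x | _].
have -> : #|A :&: B| = 0%N.
  apply/eqP; rewrite cards_eq0; apply/eqP/setP => -[i j]; rewrite !inE /=.
  by case: (ord2_cases i) => ->; rewrite !andbF.
rewrite subn0 !card_level_set //; last by lia.
by case/andP => _ ?; lia.
Qed.

Lemma sum_ideals (R : nmodType) (F : {set chain2 n} -> R) a b :
    (a <= b)%N -> (b <= n)%N ->
  \sum_(J | is_ideal J && (J \subset ideal_ab n a b)) F J =
    \sum_(0 <= a' < a.+1) \sum_(a' <= b' < b.+1) F (ideal_ab n a' b').
Proof.
move=> ab bn; have an := leq_trans ab bn.
transitivity (\sum_(p : 'I_n.+1 * 'I_n.+1 |
      [&& (p.1 < a.+1)%N, (p.2 < b.+1)%N & (p.1 <= p.2)%N])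
    F (ideal_ab n p.1 p.2)).
  have lt_n1 (p : 'I_n.+1) : (p <= n)%N by rewrite -ltnS ltn_ord.
  rewrite (reindex_onto (fun p : 'I_n.+1 * 'I_n.+1 => ideal_ab n p.1 p.2)
     (fun J => (inord (row_length J ord_max), inord (row_length J ord0)))) /=.
    apply: eq_bigl => -[p1 p2] /=.
    rewrite !row_length_ab //= !inord_val eqxx andbT subset_ideal_ab // !ltnS.
    have -> : is_ideal (ideal_ab n p1 p2) = (p1 <= p2)%N.
      apply/idP/idP => [idJ|]; last exact: is_ideal_ab.
      by have := row_length_mono idJ; rewrite !row_length_ab.
    by rewrite andbC andbA.
  move=> J /andP [idJ _] /=; rewrite !inordK ?ltnS ?row_length_le //.
  exact/esym/ideal_chain2.
rewrite big_mkord (@big_ord_widen _ _ _ a.+1 n.+1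
  (fun a' => \sum_(a' <= b' < b.+1) F (ideal_ab n a' b'))) //.
rewrite (eq_bigr (fun i : 'I_n.+1 => \sum_(j < n.+1 | (j < b.+1)%N && (i <= j)%N)
   F (ideal_ab n i j))); last first.
  move=> i _; rewrite big_geq_mkord (@big_ord_widen_cond _ _ _ b.+1 n.+1
    (fun j => i <= j)%N (fun j => F (ideal_ab n i j))) //.
  by apply: eq_bigl => j; rewrite andbC.
rewrite pair_big_dep /=.
by apply: eq_bigl.
Qed.

Lemma Nab0 (R : nzRingType) a b : (a <= b)%N -> (b <= n)%N ->
  Nab R n 0 a b = (b == 0)%N%:R.
Proof.
move=> ab bn; rewrite /Nab transfer_poly0 ?is_ideal_ab //.
congr ((_ : bool)%:R); apply/eqP/eqP => [E|b0].
  have := row_length_ab ord0 (leq_trans ab bn) bn; rewrite E /= => <-.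
  by rewrite /row_length big_pred0 // => j; rewrite inE.
have a0 : a = 0%N by lia.
by apply/setP => x; rewrite mem_ideal_ab a0 b0 inE if_same.
Qed.

Lemma NabS (R : nzRingType) k a b : (a <= b)%N -> (b <= n)%N ->
  Nab R n k.+1 a b =
    \sum_(0 <= a' < a.+1) \sum_(a' <= b' < b.+1)
      'X^((a' < a) + ((b' < b) && (a < b)))%N * Nab R n k a' b'.
Proof.
move=> ab bn; rewrite /Nab transfer_polyS ?is_ideal_ab // sum_ideals //.
apply: eq_big_nat => a' aa; apply: eq_big_nat => b' bb.
by rewrite card_max_set_ab //; lia.
Qed.

End Chain2Ideals.

(** * Telescoping sums and the determinantal evaluation *)

Section Telescoping.
Variable R : comNzRingType.
Implicit Types f : nat -> {poly R}.

(* [f] is extended by [f (-1) = 0]. *)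
Definition prev f a : {poly R} := if a is a'.+1 then f a' else 0.
Definition backward_diff f a : {poly R} := f a - prev f a.

Lemma sum_backward_diff f a :
  \sum_(0 <= i < a.+1) backward_diff f i = f a.
Proof.
elim: a => [|a IH]; first by rewrite big_nat1 /backward_diff subr0.
by rewrite big_nat_recr //= IH /backward_diff /= addrC subrK.
Qed.

Lemma weighted_sum m b (f : nat -> {poly R}) : (m <= b)%N ->
  \sum_(m <= i < b.+1) 'X^(i < b)%N * f i =
    'X * \sum_(m <= i < b) f i + f b.
Proof.
move=> mb; rewrite big_nat_recr //= ltnn mul1r; congr (_ + _).
by rewrite big_distrr /=; apply: eq_big_nat => i /andP [_ ->].
Qed.

Lemma weighted_sum_diff f a :
  \sum_(0 <= i < a.+1) 'X^(i < a)%N * backward_diff f i =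
    f a - (1 - 'X) * prev f a.
Proof.
rewrite weighted_sum //; case: a => [|a].
  by rewrite big_nil /backward_diff /= !mulr0 add0r.
by rewrite sum_backward_diff /backward_diff /=; ring.
Qed.

Lemma weighted_sum_top m b f : (m <= b)%N ->
  \sum_(m <= i < b.+2) 'X^(i < b.+1)%N * f i =
    \sum_(m <= i < b.+2) f i - (1 - 'X) * \sum_(m <= i < b.+1) f i.
Proof.
move=> mb; rewrite weighted_sum ?(leqW mb) // [in RHS]big_nat_recr ?(leqW mb) //=.
by ring.
Qed.

End Telescoping.

Section ColumnSums.
Variables (R : realType) (n : nat).

Local Notation P := (fun k a => narayana R a k).
Local Notation U := (fun k b => shifted_narayana R b k).
Local Notation V := (fun k a => shifted_narayana R k a).

(** The right side is what the sum weighted by x^[i < a] produces at level k ([weighted_sum_diff]);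
    rewriting it as a difference at level k+1 lets the induction on k close. *)
Lemma narayana_step k a :
  backward_diff (P k.+1) a = P k a - (1 - 'X) * prev (P k) a.
Proof.
case: a => [|a].
  rewrite /backward_diff /= subr0 mulr0 subr0; apply/polyP => -[|i].
    by rewrite !coef_narayana !bin0.
  by rewrite !coef_narayana bin0n !mul0n.
rewrite /backward_diff /= mulrBl mul1r; apply/polyP => i.
rewrite !(coefD, coefN, coefXM) !coef_narayana.
case: i => [|i] /=; first by rewrite !bin0; ring.
by rewrite !binS !natrM !natrD; ring.
Qed.

Lemma shifted_narayana_col_step k a :
  backward_diff (V k.+2) a = V k.+1 a - (1 - 'X) * prev (V k.+1) a.
Proof.
case: a => [|a].
  rewrite /backward_diff /= subr0 mulr0 subr0; apply/polyP => -[|i].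
    by rewrite !coef0_shifted_narayana.
  by rewrite !coef_shifted_narayana (@bin_small 1 i.+2) ?muln0.
rewrite /backward_diff /= mulrBl mul1r; apply/polyP => -[|i].
  rewrite !(coefD, coefN) [('X * shifted_narayana _ _ _)`_0]coefXM.
  by rewrite !coef0_shifted_narayana /= !subr0.
rewrite !(coefD, coefN) [('X * shifted_narayana _ _ _)`_i.+1]coefXM.
rewrite !coef_shifted_narayana /=.
case: i => [|i]; rewrite ?coef0_shifted_narayana ?coef_shifted_narayana /=.
  by rewrite !bin0 !binS !natrM !natrD; ring.
by rewrite !binS !natrM !natrD; ring.
Qed.

(** The index starts at b+2 because the truncated predecessor makes [U k 0] equal to [U k 1] instead
    of zero. *)
Lemma shifted_narayana_row_step k b :
  backward_diff (U k.+1) b.+2 = U k b.+2 - (1 - 'X) * U k b.+1.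
Proof.
rewrite /backward_diff /= mulrBl mul1r; apply/polyP => -[|i].
  rewrite !(coefD, coefN) [('X * shifted_narayana _ _ _)`_0]coefXM.
  by rewrite !coef0_shifted_narayana /= !subr0.
rewrite !(coefD, coefN) [('X * shifted_narayana _ _ _)`_i.+1]coefXM.
rewrite !coef_shifted_narayana /=.
case: i => [|i]; rewrite ?coef0_shifted_narayana ?coef_shifted_narayana /=.
  by rewrite !bin0 !binS !natrM !natrD; ring.
by rewrite !binS !natrM !natrD; ring.
Qed.

Lemma shifted_narayana0 b : shifted_narayana R b 0 = 0.
Proof.
apply/polyP => -[|i]; rewrite coef0 ?coef0_shifted_narayana //.
by rewrite coef_shifted_narayana (@bin_small 1) ?muln0.
Qed.

Lemma shifted_narayana1 b : shifted_narayana R b 1 = 'X.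
Proof.
apply/polyP => -[|[|i]]; rewrite coefX ?coef0_shifted_narayana //.
  by rewrite coef_shifted_narayana bin0.
by rewrite coef_shifted_narayana (@bin_small 2) ?muln0.
Qed.

(** For k = 0 truncation breaks the step for V, but there U vanishes, and on the right [U 1] is
    constantly x, so its difference is zero. For a = 0 the V factors vanish on both sides. *)
Lemma cross_step k a b : (a <= b)%N ->
  (V k a - (1 - 'X) * prev (V k) a) * (U k b.+1 - (1 - 'X) * U k b) =
    backward_diff (V k.+1) a * backward_diff (U k.+1) b.+1.
Proof.
case: a => [|a] ab.
  by rewrite /backward_diff /= !shifted_narayana0 mulr0 subr0 !mul0r.
case: b ab => // b _.
case: k => [|k]; last by rewrite shifted_narayana_col_step shifted_narayana_row_step.
rewrite /backward_diff /= !shifted_narayana0 !shifted_narayana1.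
by rewrite subrr mulr0 subrr !mulr0.
Qed.

Lemma col_step k a b :
  (V k a - (1 - 'X) * prev (V k) a) * U k b = backward_diff (V k.+1) a * U k b.
Proof.
by case: k => [|k]; rewrite ?shifted_narayana0 ?mulr0 // shifted_narayana_col_step.
Qed.

(** For positive a each of the four factors is a multiple of the same x E: by (k+1) and a on the
    left, by a and (k+1) on the right. This reconciles the diagonal value, which still involves
    level k, with the closed form. *)
Lemma diagonal_step k a :
  backward_diff (P k.+1) a * (P k.+1 a - P k a) =
    backward_diff (V k.+1) a * (U k.+1 a - U k a).
Proof.
case: a => [|a].
  have -> : P k.+1 0%N = P k 0%N.
    by have := narayana_step k 0; rewrite /backward_diff /= mulr0 !subr0.
  by rewrite /backward_diff /= !shifted_narayana0 subrr mulr0 subr0 mul0r.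
have narayana_sym s l : narayana R s l = narayana R l s.
  by apply/polyP => i; rewrite !coef_narayana mulnC.
rewrite /backward_diff /= narayana_diff shifted_narayana_diff.
rewrite ![narayana R a.+1 _]narayana_sym narayana_diff shifted_narayana_diff.
by rewrite [narayana_mean R k a]narayana_mean_sym -!scalerAl -!scalerAr !scalerA mulrC.
Qed.

Theorem column_sum k a b : (a <= b)%N -> (b <= n)%N ->
  \sum_(a <= b' < b.+1) Nab R n k a b' =
    backward_diff (P k) a * P k b - backward_diff (V k) a * U k b.
Proof.
elim: k a b => [|k IH] a b ab bn.
  have P0 l : P 0%N l = 1.
    by apply/polyP => -[|i]; rewrite coef_narayana coef1 ?bin0 // (@bin_small 0) ?muln0.
  rewrite /= shifted_narayana0 mulr0 subr0 P0 mulr1.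
  rewrite (eq_big_nat _ _ (F2 := fun b' => (b' == 0)%N%:R)); last first.
    by move=> b' /andP [ab' bb']; rewrite Nab0 //; lia.
  case: a ab => [|a] ab; rewrite /backward_diff /= ?P0.
    rewrite subr0 big_ltn // big_nat big1 ?addr0 // => i /andP [].
    by case: i.
  by rewrite subrr big_nat big1 // => i /andP []; case: i.
(* On the diagonal the weight in b' is trivial, so the inner sums are column sums at level k and
   only the sum over a' is weighted. *)
have diag : Nab R n k.+1 a a =
    backward_diff (P k.+1) a * P k a - backward_diff (V k.+1) a * U k a.
  have an := leq_trans ab bn.
  rewrite NabS // (eq_big_nat _ _ (F2 := fun a' => 'X^(a' < a)%N *
      backward_diff (P k) a' * P k a -
      'X^(a' < a)%N * backward_diff (V k) a' * U k a)).
    by rewrite sumrB -!big_distrl /= !weighted_sum_diff col_step narayana_step.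
  move=> a' /andP [_ aa]; rewrite -!mulrA -mulrBr -IH //.
  by rewrite big_distrr; apply: eq_bigr => b' _; rewrite ltnn andbF addn0.
(* Off the diagonal the two weights separate, so both factors become differences at level k+1;
   summing over b then telescopes down to the diagonal term. *)
have off b1 : (a <= b1)%N -> (b1.+1 <= n)%N -> Nab R n k.+1 a b1.+1 =
    backward_diff (P k.+1) a * backward_diff (P k.+1) b1.+1
    - backward_diff (V k.+1) a * backward_diff (U k.+1) b1.+1.
  move=> ab1 bn1; rewrite NabS //; last exact: leqW.
  rewrite (eq_big_nat _ _ (F2 := fun a' => 'X^(a' < a)%N * backward_diff (P k) a' *
      (P k b1.+1 - (1 - 'X) * P k b1) -
      'X^(a' < a)%N * backward_diff (V k) a' * (U k b1.+1 - (1 - 'X) * U k b1))).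
    rewrite sumrB -!big_distrl /= !weighted_sum_diff cross_step //.
    by rewrite !narayana_step.
  move=> a' /andP [_ aa]; transitivity ('X^(a' < a)%N *
      \sum_(a' <= b' < b1.+2) 'X^(b' < b1.+1)%N * Nab R n k a' b').
    rewrite big_distrr; apply: eq_bigr => b' _.
    by rewrite [(a < b1.+1)%N]ltnS ab1 andbT exprD -mulrA.
  rewrite weighted_sum_top; last by lia.
  by rewrite !IH; [ring | lia..].
elim: b ab bn => [|b IHb] ab bn.
  have a0 : a = 0%N by lia.
  rewrite a0 in diag *; rewrite big_nat1 diag; have := diagonal_step k 0.
  move=> /eqP; rewrite -subr_eq0 => /eqP D; apply/eqP; rewrite -subr_eq0 -oppr_eq0.
  by rewrite -D; apply/eqP; ring.
have [aeq|ab'] := eqVneq a b.+1.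
  rewrite aeq in diag *; rewrite big_nat1 diag; have := diagonal_step k b.+1.
  move=> /eqP; rewrite -subr_eq0 => /eqP D; apply/eqP; rewrite -subr_eq0 -oppr_eq0.
  by rewrite -D; apply/eqP; ring.
have {ab'}ab : (a <= b)%N by lia.
rewrite big_nat_recr ?(leqW ab) //= IHb ?off //; last exact: ltnW.
by rewrite /backward_diff /=; ring.
Qed.

Lemma Lpoly_closed k s : (s <= n)%N ->
  Lpoly R n k s = P k n * P k s - U k n * V k s.
Proof.
move=> sn; rewrite /Lpoly (eq_big_nat _ _ (F2 := fun a =>
   backward_diff (P k) a * P k n - backward_diff (V k) a * U k n)).
  rewrite sumrB -!big_distrl /= !sum_backward_diff.
  by rewrite ![_ * P k n]mulrC ![_ * U k n]mulrC.
by move=> a sa; apply: column_sum => //; lia.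
Qed.

Lemma Rpoly_closed k s : (s < n)%N ->
  Rpoly R n k s = P k n * (P k s.+1 - P k s) - U k n * (V k s.+1 - V k s).
Proof.
move=> sn; rewrite /Rpoly column_sum // /backward_diff /=.
by rewrite ![_ * P k n]mulrC ![_ * U k n]mulrC.
Qed.

End ColumnSums.

Theorem theorem1p1 (R : realType) (n k s : nat)
    (hn : (1 <= n)%N) (hk : (1 <= k)%N) (hs : (s <= n - 1)%N) :
  exists h : {poly R}, common_interleaver (Lpoly R n k s) (Rpoly R n k s) h.
Proof.
have sn : (s < n)%N by lia.
(* Positivity of k is what allows c = (s+1)/k; the determinant theorem is stated with k+1 in its
   place. *)
case: k hk => // k _; rewrite (Lpoly_closed R _ (ltnW sn)) (Rpoly_closed R _ sn).
have [ls [ms [[a a0 ->] [b b0 ->] Hc]]] := @determinants_interlacing R n k s sn.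
exact: common_interleaver_of_count.
Qed.
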